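(* Let $n\ge1$, let $\boldsymbol{m}=(m_1,\dots,m_n)\in\mathbb{N}_0^n$ with $m_1,\dots,m_n$ distinct, and let $\boldsymbol{t}_{\boldsymbol{m}}=(t_{m_1},\dots,t_{m_n})\in\mathbb{R}^n$. Let $\tau_{\boldsymbol{m}}(z;\boldsymbol{t}_{\boldsymbol{m}})$ and $P_{\boldsymbol{m};i}(z;\boldsymbol{t}_{\boldsymbol{m}})$, $i\in\mathbb{N}_0$, be the polynomials defined in the context. Then $\tau_{\boldsymbol{m}}(z;\boldsymbol{t}_{\boldsymbol{m}})$ has no zeros on $[-1,1]$ if and only if $$t_{m_j}>-m_j-\tfrac12,\qquad j\in\{1,\dots,n\}.$$ If these conditions hold, then $\{P_{\boldsymbol{m};i}(z;\boldsymbol{t}_{\boldsymbol{m}})\}_{i\in\mathbb{N}_0}$ is a family of exceptional Legendre polynomials (with respect to $\tau=\tau_{\boldsymbol{m}}(z;\boldsymbol{t}_{\boldsymbol{m}})$), with $$\int_{-1}^1\frac{P_{\boldsymbol{m};i_1}(u;\boldsymbol{t}_{\boldsymbol{m}})P_{\boldsymbol{m};i_2}(u;\boldsymbol{t}_{\boldsymbol{m}})}{\tau_{\boldsymbol{m}}(u;\boldsymbol{t}_{\boldsymbol{m}})^2}\,du=\frac{2}{1+2i_1+2(\delta_{i_1m_1}+\cdots+\delta_{i_1m_n})t_{i_1}}\,\delta_{i_1i_2},\qquad i_1,i_2\in\mathbb{N}_0,$$ and $L^2$-completeness in $[-1,1]$ relative to the measure $\tau_{\boldsymbol{m}}(z;\boldsymbol{t}_{\boldsymbol{m}})^{-2}\,dz$.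 (Here $t_{i_1}$ is the parameter $t_{m_k}$ when $i_1=m_k$; when $i_1\notin\{m_1,\dots,m_n\}$ the term containing $t_{i_1}$ is $0$.)
   Context: $\mathbb{N}_0=\{0,1,2,\dots\}$. $D_z$ is the derivative in $z$, and subscripts $z$ denote derivatives. $\delta_{ij}$ is the Kronecker delta. For a polynomial $\tau=\tau(z)$ define the operator $$\hat T(\tau)=(1-z^2)\Big(D_z^2-2\frac{\tau_z}{\tau}D_z+\frac{\tau_{zz}}{\tau}\Big)-2zD_z .$$ Exceptional Legendre polynomials: let $\tau(z)$ be a polynomial that does not vanish in $[-1,1]$. A set of polynomials $\{\hat P_i(z)\}_{i\in\mathbb{N}_0}$ is a family of exceptional Legendre polynomials (with respect to $\tau$) if (i) the $\hat P_i$ are eigenfunctions of a Sturm--Liouville problem in $[-1,1]$, namely $\hat T(\tau)\hat P_i=\lambda_i\hat P_i$ for constants $\lambda_i$; (ii) $\{\deg\hat P_i\}_{i\in\mathbb{N}_0}$ contains all but finitely many positive integers; (iii) $\int_{-1}^1\hat P_{i_1}(z)\hat P_{i_2}(z)\tau(z)^{-2}dz=0$ for $i_1\ne i_2$; (iv) the $\hat P_i$ form a complete set in the Hilbert space $L^2([-1,1],\tau^{-2}dz)$. Classical Legendre polynomials: $P_i(z)=\frac{2^{-i}}{i!}D_z^i(z^2-1)^i$, $i\in\mathbb{N}_0$. For $i,j\in\mathbb{N}_0$ let $R_{ij}(z)=\int_{-1}^zP_i(u)P_j(u)\,du$. For an $n$-tuple $\boldsymbol{m}=(m_1,\dots,m_n)\in\mathbb{N}_0^n$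 with associated real parameters $\boldsymbol{t}_{\boldsymbol{m}}=(t_{m_1},\dots,t_{m_n})\in\mathbb{R}^n$, let $\mathcal{R}_{\boldsymbol{m}}(z;\boldsymbol{t}_{\boldsymbol{m}})$ be the $n\times n$ matrix with polynomial entries $[\mathcal{R}_{\boldsymbol{m}}]_{k\ell}=\delta_{k\ell}+t_{m_\ell}R_{m_km_\ell}(z)$, let $\tau_{\boldsymbol{m}}(z;\boldsymbol{t}_{\boldsymbol{m}})=\det\mathcal{R}_{\boldsymbol{m}}(z;\boldsymbol{t}_{\boldsymbol{m}})$, and let $\boldsymbol{Q}_{\boldsymbol{m}}(z;\boldsymbol{t}_{\boldsymbol{m}})$ be the $n$-tuple of polynomials given by $$\boldsymbol{Q}_{\boldsymbol{m}}^{T}=\tau_{\boldsymbol{m}}\,\mathcal{R}_{\boldsymbol{m}}^{-1}\,(P_{m_1}(z),\dots,P_{m_n}(z))^{T}$$ (the inverse being taken over the rational functions in $z$; note $\tau_{\boldsymbol{m}}(-1)=1$). For $i\in\mathbb{N}_0$, with $(\boldsymbol{m},i)=(m_1,\dots,m_n,i)$ and $\boldsymbol{t}_{(\boldsymbol{m},i)}=(t_{m_1},\dots,t_{m_n},t_i)$, define $P_{\boldsymbol{m};i}(z;\boldsymbol{t}_{\boldsymbol{m}})=[\boldsymbol{Q}_{(\boldsymbol{m},i)}(z;\boldsymbol{t}_{(\boldsymbol{m},i)})]_{n+1}$, the last component; it does not depend on the last parameter $t_i$. *)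

(* Defs.v *)
From mathcomp Require Import all_boot all_order all_algebra fraction.
From mathcomp Require Import all_classical all_reals all_analysis.

Set Implicit Arguments.
Unset Strict Implicit.
Unset Printing Implicit Defensive.

Import Order.TTheory GRing.Theory Num.Theory.
Import numFieldNormedType.Exports.

Local Open Scope classical_set_scope.
Local Open Scope ring_scope.

Section ExceptionalFamilies.
Variable R : realType.
Implicit Types (tau p : {poly R}) (P : nat -> {poly R}).

Definition nonvanishing tau : Prop :=
  forall z : R, -1 <= z <= 1 -> tau.[z] != 0.

(* Evaluated pointwise; meaningful only where [tau.[z] != 0]. *)
Definition T_hat tau p (z : R) : R :=
  (1 - z ^+ 2) * (p^`(2).[z]
                  - 2 * (tau^`().[z] / tau.[z]) * p^`().[z]
                  + tau^`(2).[z] / tau.[z] * p.[z])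
  - 2 * z * p^`().[z].

Definition eigenpolynomial tau p : Prop :=
  p != 0 /\ exists lambda : R,
    forall z : R, tau.[z] != 0 -> T_hat tau p z = lambda * p.[z].

Definition L2_pairing tau (f g : R -> R) : R :=
  \int[lebesgue_measure]_(u in `[-1, 1]) (f u * g u / tau.[u] ^+ 2).

Definition L2_sqnorm tau (f : R -> R) : \bar R :=
  (\int[lebesgue_measure]_(u in `[(-1)%R, 1%R]) (f u ^+ 2 / tau.[u] ^+ 2)%R%:E)%E.

Definition in_L2 tau (f : R -> R) : Prop :=
  measurable_fun (`[-1, 1] : set R) f /\ (L2_sqnorm tau f < +oo)%E.

(* The linear span of the family is dense. *)
Definition L2_complete tau P : Prop :=
  forall f : R -> R, in_L2 tau f ->
  forall eps : R, 0 < eps ->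
  exists (N : nat) (c : 'I_N -> R),
    (L2_sqnorm tau (fun z => f z - \sum_(i < N) c i * (P i).[z])%R < eps%:E)%E.

(* [size p = d.+1] says that [p] is nonzero of degree [d]. *)
Record exceptional_legendre tau P : Prop := {
  exceptional_nonvanishing : nonvanishing tau;
  exceptional_eigen : forall i, eigenpolynomial tau (P i);
  exceptional_degrees :
    finite_set [set d : nat | (0 < d)%N /\ ~ exists i, size (P i) = d.+1];
  exceptional_orthogonal : forall i1 i2 : nat, i1 <> i2 ->
    L2_pairing tau (horner (P i1)) (horner (P i2)) = 0;
  exceptional_complete : L2_complete tau P }.

End ExceptionalFamilies.

Section Legendre.
Variable R : realType.
Implicit Types (p : {poly R}) (t : nat -> R).

Definition legendre (i : nat) : {poly R} :=
  (2 ^- i / i`!%:R) *: (('X ^+ 2 - 1) ^+ i)^`(i).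

(* The antiderivative of [p] with zero constant term. *)
Definition antideriv p : {poly R} :=
  \poly_(k < (size p).+1) (if k is j.+1 then p`_j / j.+1%:R else 0).

Definition legendre_int (i j : nat) : {poly R} :=
  let q := antideriv (legendre i * legendre j) in q - q.[-1]%:P.

Lemma antiderivK p : (antideriv p)^`() = p.
Proof.
apply/polyP => k; rewrite coef_deriv coef_poly ltnS.
case: ltnP => [kp|pk]; last by rewrite ?mul0rn nth_default.
by rewrite -[LHS]mulr_natr divfK// pnatr_eq0.
Qed.

Lemma legendre_intE (i j : nat) (z : R) : -1 <= z ->
  (legendre_int i j).[z] =
  \int[lebesgue_measure]_(u in `[-1, z]) ((legendre i).[u] * (legendre j).[u]).
Proof.
rewrite le_eqVlt => /predU1P[<-|z1].
  by rewrite set_itv1 Rintegral_set1 /legendre_int !hornerE subrr.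
rewrite /Rintegral.
rewrite (_ : (fun x => _) =
  (fun x => ((legendre i * legendre j).[x])%:E)); last first.
  by apply/funext => x; rewrite hornerM.
set p := legendre i * legendre j.
rewrite (@continuous_FTC2 _ _ (horner (antideriv p)) _ _ z1).
- by rewrite /legendre_int -/p !hornerE.
- by apply: continuous_subspaceT; exact: continuous_horner.
- split.
  + by move=> x _; exact: derivable_horner.
  + by apply: cvg_at_right_filter; exact: continuous_horner.
  + by apply: cvg_at_left_filter; exact: continuous_horner.
- by move=> x _; rewrite -derivE antiderivK.
Qed.

(* The parameters are indexed by the values of the tuple: [t (tnth m l)]
   is the parameter attached to the entry [tnth m l]; only these values of
   [t] are used. *)
Section Tuple.
Variables (n : nat) (m : n.-tuple nat) (t : nat -> R).

Definition R_mx : 'M[{poly R}]_n :=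
  \matrix_(k, l) ((k == l)%:R
                  + t (tnth m l) *: legendre_int (tnth m k) (tnth m l)).

Definition tau_poly : {poly R} := \det R_mx.

Definition legendre_col : 'cV[{poly R}]_n := \col_k legendre (tnth m k).

(* [\adj R_mx] is [tau_poly] times the inverse of [R_mx]: see [Q_colE]. *)
Definition Q_col : 'cV[{poly R}]_n := \adj R_mx *m legendre_col.

Lemma tau_polyN1 : tau_poly.[-1] = 1.
Proof.
rewrite /tau_poly -[LHS]/(horner_eval (-1) (\det R_mx)) -det_map_mx.
rewrite -[RHS](@det1 R n); congr (\det _); apply/matrixP => k l.
rewrite !mxE /= /horner_eval hornerD hornerZ /legendre_int !hornerE subrr mulr0.
by rewrite addr0; case: (k == l); rewrite ?hornerC.
Qed.

Lemma Q_colE : map_mx (@tofrac {poly R}) Q_col =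
  tofrac tau_poly *: (invmx (map_mx (@tofrac {poly R}) R_mx)
                      *m map_mx (@tofrac {poly R}) legendre_col).
Proof.
have tau0 : tofrac tau_poly != 0.
  rewrite tofrac_eq0; apply/eqP => tau0.
  by have /eqP := tau_polyN1; rewrite tau0 horner0 eq_sym oner_eq0.
have Ru : map_mx (@tofrac {poly R}) R_mx \in unitmx.
  by rewrite unitmxE det_map_mx unitfE.
rewrite map_mxM map_mx_adj /invmx Ru det_map_mx -scalemxAl scalerA.
by rewrite mulfV// scale1r.
Qed.

End Tuple.

Definition exc_poly (n : nat) (m : n.-tuple nat) t (i : nat) : {poly R} :=
  Q_col [tuple of rcons m i] t ord_max 0.

Lemma exc_poly_indep (n : nat) (m : n.-tuple nat) t t' (i : nat) :
  (forall j, t (tnth m j) = t' (tnth m j)) -> exc_poly m t i = exc_poly m t' i.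
Proof.
move=> tt'; rewrite /exc_poly /Q_col !mxE; apply: eq_bigr => k _.
rewrite !mxE /cofactor; congr (_ * \det _ * _).
apply/matrixP => a b; rewrite !mxE.
have -> : tnth [tuple of rcons m i] (lift ord_max b) = tnth m b.
  rewrite !(tnth_nth 0%N) /= nth_rcons size_tuple /bump.
  by rewrite (leqNgt n b) (ltn_ord b) add0n (ltn_ord b).
by rewrite tt'.
Qed.

End Legendre.

(* Main.v *)
Require Import Defs.
From mathcomp Require Import all_boot all_order all_algebra.
From mathcomp Require Import all_classical all_reals all_analysis.
From mathcomp Require Import measurable_realfun perm ring lra zify.

Set Implicit Arguments.
Unset Strict Implicit.
Unset Printing Implicit Defensive.

Import Order.TTheory GRing.Theory Num.Theory.
Import numFieldNormedType.Exports.

Local Open Scope classical_set_scope.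
Local Open Scope ring_scope.

(** Write [w = 1 - X^2] and let [M = I + G T] be the matrix [R_mx m t], where
    [G] is the Gram matrix of the seeds [P_(m_k)] on [[-1, z]] and [T] the
    diagonal matrix of the parameters. Since [G' = P P^T] has rank one, the
    vector [M^-1 P] and the functions [phi_i = P_i - r_i T M^-1 P], with [r_i]
    the row of integrals of [P_i] against the seeds, can be differentiated
    explicitly. Expanding the bordered determinant shows that the [i]-th
    exceptional polynomial is [tau * phi_i] ([exc_poly_darboux]), so the whole
    theory is that of this Darboux transformation of the Legendre family.

    - Eigenfunctions. The integrated Sturm--Liouville identity
      [(lam_k - lam_l) G_kl = w (P_k' P_l - P_k P_l')] says that [M] commutes
      with the diagonal matrix of eigenvalues up to a term of rank two
      ([gram_spectral]). Together with [tau' = P^T T Q], [Q = tau M^-1 P]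
      (Jacobi), this yields the differential equation of the transforms, with
      the eigenvalue [- i (i + 1)] unchanged ([darboux_ode]).
    - Norms. The function [kappa_ij / tau = R_ij - r_i T M^-1 r_j^T] is an
      antiderivative of [phi_i phi_j] ([deriv_darboux_gram]). It vanishes at
      [-1], and at [1] the orthogonality of the Legendre polynomials makes [M]
      diagonal, which gives the stated value ([kappa1]).
    - Zeros of [tau]. If [tau] has no zero, the squared norm of [phi_(m_j)] is
      nonnegative, which forces the lower bound on the parameter
      ([parameter_bound_nonvanishing]). Conversely a kernel vector of [M] at
      some [z] contradicts Bessel's inequality for a combination of the seeds
      restricted to [[-1, z]] ([nonvanishing_parameter_bound]).
    - Degrees. Comparing top coefficients in the differential equation gives
      [deg (tau phi_i) = deg tau + i] as soon as [i >= deg tau]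
      ([size_eigenpolynomial]).
    - Completeness. The transform [f |-> f - r_f T M^-1 P] is invertible, with
      inverse [s |-> s + P^T T y], [y' = s M^-1 P]. For [s = tau w], with [w] a
      polynomial, the preimage is a polynomial; hence the span of the
      exceptional polynomials contains [tau^2 w] for every polynomial [w]
      ([exc_poly_span]). As [tau^2] is bounded above and below on [[-1, 1]],
      completeness follows from the density of the polynomials in [L^2]
      ([poly_dense_L2]), obtained here by truncation, approximation by
      continuous functions and Bernstein polynomials. *)

(** * Antiderivatives of polynomials *)

Section PolynomialCalculus.
Variable R : realType.
Implicit Types p q : {poly R}.

Lemma poly_deriv_inj (a : R) p q : p^`() = q^`() -> p.[a] = q.[a] -> p = q.
Proof.
move=> dpq pqa; apply/eqP; rewrite -subr_eq0; apply/eqP.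
have d0 : (p - q)^`() = 0 by rewrite derivB dpq subrr.
have pqC : p - q = ((p - q)`_0)%:P.
  apply/polyP => -[|k]; rewrite coefC//=.
  have /(congr1 (fun r : {poly R} => r`_k)) := d0.
  rewrite coef_deriv coef0 => /eqP.
  by rewrite mulrn_eq0 /= => /eqP.
have : (p - q).[a] = 0 by rewrite !hornerE pqa subrr.
by rewrite pqC hornerC => ->.
Qed.

(** The base point is [-1], the lower end of all the integrals involved. *)
Definition primitive p : {poly R} := antideriv p - (antideriv p).[-1]%:P.

Lemma deriv_primitive p : (primitive p)^`() = p.
Proof. by rewrite /primitive derivB derivC subr0 antiderivK. Qed.

Lemma primitiveN1 p : (primitive p).[-1] = 0.
Proof. by rewrite /primitive !hornerE subrr. Qed.

Lemma primitive_unique p q : q^`() = p -> q.[-1] = 0 -> primitive p = q.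
Proof.
move=> dq q1; apply: (@poly_deriv_inj (-1)); first by rewrite deriv_primitive.
by rewrite primitiveN1.
Qed.

Lemma primitiveD p q : primitive (p + q) = primitive p + primitive q.
Proof.
apply: primitive_unique; first by rewrite derivD !deriv_primitive.
by rewrite hornerD !primitiveN1 addr0.
Qed.

Lemma primitiveZ (c : R) p : primitive (c *: p) = c *: primitive p.
Proof.
apply: primitive_unique; first by rewrite derivZ deriv_primitive.
by rewrite hornerZ primitiveN1 mulr0.
Qed.

Lemma primitive0 : primitive 0 = 0.
Proof. by apply: primitive_unique; rewrite ?deriv0 ?horner0. Qed.

Lemma primitive_sum (I : Type) (s : seq I) (F : I -> {poly R}) :
  primitive (\sum_(i <- s) F i) = \sum_(i <- s) primitive (F i).
Proof. exact: (big_morph _ primitiveD primitive0). Qed.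

Lemma poly_nondecreasing p (a b : R) : a <= b ->
  (forall x, a <= x <= b -> 0 <= p^`().[x]) -> p.[a] <= p.[b].
Proof.
move=> ab dp.
have dx x : derivable (horner p) x 1 by exact: derivable_horner.
apply: (ger0_derive1_le_cc (f := horner p) (a := a) (b := b)).
- by move=> x _; exact: dx.
- move=> x; rewrite in_itv /= -derivE => /andP[ax xb].
  by apply: dp; rewrite !ltW.
- by apply: continuous_subspaceT; exact: continuous_horner.
- by rewrite in_itv /= lexx ab.
- by rewrite in_itv /= lexx ab.
- exact: ab.
Qed.

End PolynomialCalculus.

(** * Legendre polynomials *)

Section LegendreFacts.
Variable R : realType.
Implicit Types p q : {poly R}.
Local Notation P := (legendre R).

Local Notation V n := (('X ^+ 2 - 1 : {poly R}) ^+ n).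

(** The relation [(X^2 - 1) V' = 2 n X V], satisfied by [V = (X^2 - 1)^n], is
    differentiated [k + 1] times; for [k = n] it becomes Legendre's equation. *)
Lemma rodrigues_ode (n k : nat) :
  ('X ^+ 2 - 1) * (V n)^`(k.+2)
  + (2 * k.+1%:R - 2 * n%:R) * ('X * (V n)^`(k.+1))
  + (k.+1%:R * (k%:R - 2 * n%:R)) * (V n)^`(k) = 0.
Proof.
have dX2 : ('X ^+ 2 - 1 : {poly R})^`() = 2 * 'X.
  by rewrite derivB derivXn (derivC 1) subr0 expr1 mulr_natl.
have dN (a : nat) : (a%:R : {poly R})^`() = 0 by rewrite -polyC_natr derivC.
elim: k => [|k IH].
  have H : ('X ^+ 2 - 1) * (V n)^`() = (2 * n%:R) * 'X * V n.
    rewrite deriv_exp dX2; case: n => [|n]; first by ring.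
    by rewrite /= -mulr_natr [in RHS]exprS; ring.
  have /(congr1 (@deriv R)) := H.
  rewrite !derivM dX2 derivX !dN => H'.
  rewrite derivnS derivn1 derivn0.
  rewrite (_ : _ + _ = (2 * 'X * (V n)^`() + ('X ^+ 2 - 1) * (V n)^`()^`())
    - (2 * n%:R) * V n - (2 * n%:R * 'X) * (V n)^`()); last by ring.
  by rewrite H'; ring.
have /(congr1 (@deriv R)) := IH.
rewrite !(dX2, dN, derivX, deriv0, derivB, derivM, derivD) -!derivnS => H.
rewrite -[RHS]H; ring.
Qed.

Definition legendre_eigenvalue (n : nat) : R := - (n%:R * n.+1%:R).
Local Notation lam := legendre_eigenvalue.

Lemma legendre_ode n : (1 - 'X ^+ 2) * (P n)^`()^`()
  = 2 * 'X * (P n)^`() + (lam n)%:P * P n.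
Proof.
have := rodrigues_ode n n; rewrite !derivnS => H.
rewrite /legendre !derivZ -!mul_polyC.
move: (_%:P) => c; rewrite /lam polyCN polyCM !polyC_natr.
apply/eqP; rewrite -subr_eq0; apply/eqP.
rewrite (_ : _ - _ = - c * 0); first by rewrite mulr0.
by rewrite -H; ring.
Qed.

Lemma size_deriv_field p : size p^`() = (size p).-1.
Proof.
have [/size1_polyC ->|p1] := leqP (size p) 1.
  by rewrite derivC size_poly0 size_polyC; case: eqP.
rewrite /deriv; case sp: (size p) p1 => [|[|k]] // _.
rewrite size_poly_eq //= -mulr_natr mulf_neq0 ?pnatr_eq0 //.
by rewrite -[k.+1]/(k.+2.-1) -sp -lead_coefE lead_coef_eq0 -size_poly_gt0 sp.
Qed.

Lemma size_derivn p k : size p^`(k) = (size p - k)%N.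
Proof.
elim: k => [|k IH]; first by rewrite subn0.
by rewrite derivnS size_deriv_field IH subnS.
Qed.

Lemma size_legendre n : size (P n) = n.+1.
Proof.
rewrite /legendre size_scale; last first.
  by rewrite mulf_neq0 // ?invr_eq0 ?expf_neq0 ?pnatr_eq0 // -lt0n fact_gt0.
have sX : size ('X ^+ 2 - 1 : {poly R}) = 3 by rewrite size_XnsubC.
have X0 : ('X ^+ 2 - 1 : {poly R}) != 0 by rewrite -size_poly_gt0 sX.
have -> : size (V n)^`(n) = ((n * 2).+1 - n)%N.
  rewrite size_derivn -[size (V n)]prednK; last first.
    by rewrite size_poly_gt0 expf_neq0.
  by rewrite size_exp sX mulnC.
by rewrite muln2 -addnn subSn ?leq_addr // addnK.
Qed.

(** At [a], only the term of Leibniz' formula in which all the derivatives fall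
    on the power survives. *)
Lemma derivn_XsubC_exp (a : R) p n : ((('X - a%:P) ^+ n) * p)^`(n).[a] = n`!%:R * p.[a].
Proof.
elim: n p => [|n IH] p; first by rewrite expr0 mul1r mul1r.
rewrite derivSn.
have -> : (('X - a%:P) ^+ n.+1 * p)^`()
   = ('X - a%:P) ^+ n * (n.+1%:R * p + ('X - a%:P) * p^`()).
  rewrite derivM deriv_exp derivB derivX derivC subr0 mul1r /= -mulr_natr.
  by rewrite exprS; ring.
rewrite IH hornerD !hornerM -polyC_natr hornerC hornerXsubC subrr mul0r addr0.
by rewrite factS natrM mulrA [in RHS](mulrC n.+1%:R).
Qed.

Lemma legendre_sqr1 n : (P n).[1] ^+ 2 = 1.
Proof.
rewrite /legendre hornerZ.
have -> : V n = ('X - 1%:P) ^+ n * ('X + 1) ^+ n.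
  by rewrite -exprMn; congr (_ ^+ _); ring.
rewrite derivn_XsubC_exp horner_exp hornerD ?hornerN hornerX (hornerC 1).
by rewrite mulrA mulfVK ?pnatr_eq0 -?lt0n ?fact_gt0 // mulVf ?expr1n ?expf_neq0 ?pnatr_eq0.
Qed.

Lemma legendre_sqrN1 n : (P n).[-1] ^+ 2 = 1.
Proof.
rewrite /legendre hornerZ.
have -> : V n = ('X - (-1)%:P) ^+ n * ('X - 1) ^+ n.
  by rewrite -exprMn polyCN; congr (_ ^+ _); ring.
rewrite derivn_XsubC_exp horner_exp hornerD ?hornerN hornerX (hornerC 1).
rewrite mulrA mulfVK ?pnatr_eq0 -?lt0n ?fact_gt0 //.
rewrite -exprVn -exprMn -exprM mulnC exprM.
by rewrite (_ : (_ * _) ^+ 2 = 1) ?expr1n //; field.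
Qed.

Lemma legendre_int_primitive i j : legendre_int R i j = primitive (P i * P j).
Proof. by []. Qed.

(** Both sides vanish at [-1] and have the same derivative, by the
    Sturm--Liouville equation. At [1] the right-hand side vanishes again, whence
    the orthogonality of the family; for general [z] the identity controls the
    commutator of the Gram matrix with the eigenvalues. *)
Lemma wronskian_legendre i j :
  (lam i - lam j)%:P * legendre_int R i j
  = (1 - 'X ^+ 2) * ((P i)^`() * P j - P i * (P j)^`()).
Proof.
rewrite legendre_int_primitive mul_polyC -primitiveZ.
apply: primitive_unique; last by rewrite !hornerE; ring.
rewrite -mul_polyC polyCB.
have dw : (1 - 'X ^+ 2 : {poly R})^`() = - (2 * 'X).
  by rewrite derivB derivXn (derivC 1) sub0r expr1 mulr_natl.
rewrite derivM dw derivB !derivM.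
apply/eqP; rewrite -subr_eq0; apply/eqP.
rewrite (_ : _ - _ = P j * ((1 - 'X ^+ 2) * (P i)^`()^`() -
   (2 * 'X * (P i)^`() + (lam i)%:P * P i))
   - P i * ((1 - 'X ^+ 2) * (P j)^`()^`() -
   (2 * 'X * (P j)^`() + (lam j)%:P * P j))); last by ring.
by rewrite !legendre_ode !subrr !mulr0 subrr.
Qed.

Lemma legendre_intC i j : legendre_int R i j = legendre_int R j i.
Proof. by rewrite !legendre_int_primitive mulrC. Qed.

Lemma deriv_legendre_int i j : (legendre_int R i j)^`() = P i * P j.
Proof. by rewrite legendre_int_primitive deriv_primitive. Qed.

Lemma legendre_intN1 i j : (legendre_int R i j).[-1] = 0.
Proof. by rewrite legendre_int_primitive primitiveN1. Qed.

Lemma legendre_orthogonal i j : i != j -> (legendre_int R i j).[1] = 0.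
Proof.
move=> ij; have /(congr1 (fun p : {poly R} => p.[1])) := wronskian_legendre i j.
rewrite hornerM hornerC [in RHS]hornerM.
rewrite (_ : (1 - 'X ^+ 2 : {poly R}).[1] = 0) ?mul0r; last first.
  by rewrite !hornerE; ring.
move/eqP; rewrite mulf_eq0 => /orP[|/eqP //].
rewrite subr_eq0 eqr_opp -!natrM eqr_nat => /eqP eq.
exfalso; move: ij; rewrite neq_ltn => /orP[] lt; move: eq; nia.
Qed.

Lemma legendre_expansion p N : (size p <= N)%N ->
  exists c : nat -> R, p = \sum_(i < N) c i *: P i.
Proof.
elim: N p => [|N IH] p sp.
  exists (fun=> 0); rewrite big_ord0; apply/eqP.
  by rewrite -size_poly_leq0.
set a := p`_N / (P N)`_N.
have PN : (P N)`_N != 0.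
  have -> : (P N)`_N = lead_coef (P N) by rewrite lead_coefE size_legendre.
  by rewrite lead_coef_eq0 -size_poly_gt0 size_legendre.
have [|c pc] := IH (p - a *: P N).
  apply/leq_sizeP => j; rewrite leq_eqVlt => /predU1P[<-|Nj].
    by rewrite coefB coefZ /a mulfVK // subrr.
  rewrite coefB coefZ !nth_default ?mulr0 ?subr0 ?size_legendre //.
  by rewrite (leq_trans sp).
exists (fun i => if i == N then a else c i).
rewrite big_ord_recr /= eqxx -[LHS](subrK (a *: P N)) pc; congr (_ + _).
by apply: eq_bigr => i _; rewrite ltn_eqF.
Qed.

Lemma primitive_lower_degree n p : (size p <= n)%N -> (primitive (p * P n)).[1] = 0.
Proof.
move=> /legendre_expansion[c ->]; rewrite mulr_suml primitive_sum horner_sum.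
rewrite big1 // => i _; rewrite -scalerAl primitiveZ hornerZ.
by rewrite -legendre_int_primitive legendre_orthogonal ?mulr0 // ltn_eqF.
Qed.

(** The polynomial [X P_i' - i P_i] has degree less than [i], so it is orthogonal
    to [P_i]. Integrating [(X P_i^2)' = P_i^2 + 2 X P_i' P_i] therefore gives
    [2 = (2 i + 1) int P_i^2], as [P_i^2] is [1] at both end points. *)
Lemma legendre_int1 i j :
  (legendre_int R i j).[1] = (i == j)%:R * (2 / (2 * i%:R + 1)).
Proof.
have [<-|ij] := eqVneq i j; last by rewrite legendre_orthogonal // mul0r.
have := legendre_intN1 i i; have := deriv_legendre_int i i.
move: (legendre_int R i i) => I dI I1.
rewrite mul1r; set q := 'X * (P i)^`() - i%:R *: P i.
have sq : (size q <= i)%N.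
  apply/leq_sizeP => k ik; rewrite coefB coefZ coefXM coef_deriv.
  case: k ik => [|k] ik /=.
    by move: ik; rewrite leqn0 => /eqP ->; rewrite mul0r subrr.
  have [ji|ji] := eqVneq i k.+1; first by rewrite -ji mulr_natl subrr.
  rewrite nth_default ?mul0rn ?mulr0 ?subrr // size_legendre.
  by rewrite ltn_neqAle ji.
have := primitive_lower_degree sq.
(* The constant makes the right-hand side vanish at [-1]. *)
have -> : primitive (q * P i) =
    2^-1 *: ('X * P i ^+ 2 - (-1)%:P * (P i).[-1]%:P ^+ 2)
    - (i%:R + 2^-1) *: I.
  apply: primitive_unique; last first.
    by rewrite !(hornerD, hornerN, hornerZ) I1 !hornerE; ring.
  rewrite derivB !derivZ derivB dI -expr2 -polyC_exp -polyCM.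
  rewrite derivC derivM derivX deriv_exp /= /q -!mul_polyC.
  rewrite polyCD; set c : R := 2^-1.
  have c1 : 2 * c%:P = 1 :> {poly R}.
    by rewrite -polyC_natr -polyCM mulfV ?pnatr_eq0.
  rewrite (_ : _ - _ = (2 * c%:P) * ('X * (P i)^`() * P i)
    - i%:R%:P * P i ^+ 2); last by ring.
  by rewrite c1; ring.
have := legendre_sqrN1 i; have := legendre_sqr1 i.
move: (P i) I {sq q dI I1} => p I p1 pN1.
rewrite !(horner_exp, hornerD, hornerN, hornerZ, hornerM, hornerX, hornerC).
rewrite p1 pN1; move: (I.[1]) => x H.
have i0 : 2 * i%:R + 1 != 0 :> R by rewrite -natrM natr1 pnatr_eq0.
apply: (mulfI i0); rewrite [RHS]mulrC divfK //.
apply/eqP; rewrite -subr_eq0 -[X in X == _](mulr1 _); apply/eqP.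
rewrite (_ : _ * _ = - 2 * (2^-1 * (1 * 1 - - 1 * 1) - (i%:R + 2^-1) * x)).
  by rewrite H mulr0.
by field.
Qed.

End LegendreFacts.

(** * Matrices of polynomials *)

Section MatrixDerivation.
Variable R : idomainType.
Local Notation D := (map_mx (@deriv R)).

Lemma deriv_mulmx a b c (A : 'M[{poly R}]_(a, b)) (B : 'M[{poly R}]_(b, c)) :
  D (A *m B) = D A *m B + A *m D B.
Proof.
apply/matrixP => i j; rewrite !mxE raddf_sum -big_split /=.
by apply: eq_bigr => k _; rewrite !mxE derivM.
Qed.

Lemma deriv_prod (I : finType) (F : I -> {poly R}) :
  (\prod_i F i)^`() = \sum_i (F i)^`() * \prod_(j | j != i) F j.
Proof.
suff H (s : seq I) : uniq s -> (\prod_(i <- s) F i)^`() =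
   \sum_(i <- s) (F i)^`() * \prod_(j <- s | j != i) F j.
  by have := H _ (index_enum_uniq I).
elim: s => [|a s IH] /=; first by rewrite !big_nil (derivC 1).
case/andP => as_ us; rewrite big_cons derivM IH // [RHS]big_cons; congr (_ + _).
  rewrite big_cons eqxx /=; congr (_ * _); rewrite big_seq [RHS]big_seq_cond.
  by apply: eq_bigl => i; case: eqP => [->|]; rewrite ?(negPf as_) ?andbT.
rewrite mulr_sumr big_seq [RHS]big_seq; apply: eq_bigr => i is_.
rewrite big_cons (_ : a != i); first by rewrite mulrCA.
by apply: contraNneq as_ => ->.
Qed.

(** Jacobi's formula. In the derivative of the Leibniz expansion the terms are
    grouped by the row [i] that is differentiated; the matrix [B i] with that row
    differentiated has the same cofactors along row [i] as [A]. *)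
Lemma deriv_det n (A : 'M[{poly R}]_n) : (\det A)^`() = \tr (\adj A *m D A).
Proof.
pose B i := \matrix_(k, l) if k == i then (A k l)^`() else A k l.
have detB i : \det (B i) = \sum_l (A i l)^`() * cofactor A i l.
  rewrite (expand_det_row _ i); apply: eq_bigr => l _; rewrite mxE eqxx.
  congr (_ * _); rewrite /cofactor; congr (_ * \det _); apply/matrixP => a b.
  by rewrite !mxE eq_sym (negPf (neq_lift _ _)).
have -> : \tr (\adj A *m D A) = \sum_i \det (B i).
  rewrite mxtrace_mulC /mxtrace; apply: eq_bigr => i _; rewrite detB mxE.
  by apply: eq_bigr => l _; rewrite !mxE.
rewrite /determinant [RHS]exchange_big raddf_sum /=; apply: eq_bigr => s _.
have -> : ((-1) ^+ s * \prod_i A i (s i))^`()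
   = (-1) ^+ s * (\prod_i A i (s i))^`().
  by case: (odd_perm s); rewrite ?expr0 ?expr1 ?mul1r // !mulN1r derivN.
rewrite deriv_prod mulr_sumr; apply: eq_bigr => i _; congr (_ * _).
rewrite [RHS](bigD1 i) //= mxE eqxx; congr (_ * _).
by apply: eq_bigr => j ji; rewrite mxE (negPf ji).
Qed.

End MatrixDerivation.

(** * Darboux transformation along a Gram matrix *)

(** The seeds [P k] are eigenfunctions of [(1 - X^2) D^2 - 2 X D] and [G] is
    their Gram matrix. Denominators are cleared throughout: for the matrix [M]
    below, [A = \adj M] and [Q = A P] stand for [tau M^-1] and [tau M^-1 P]. *)
Section Darboux.
Variables (R : idomainType) (n : nat) (t : 'I_n -> R).
Implicit Types u v w : 'cV[{poly R}]_n.
Variables (lam : 'I_n -> R) (P : 'cV[{poly R}]_n) (G : 'M[{poly R}]_n).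
Local Notation D := (map_mx (@deriv R)).
Hypothesis G_sym : forall k l, G k l = G l k.
Hypothesis deriv_G : forall k l, (G k l)^`() = P k 0 * P l 0.
Hypothesis ode_P : forall k, (1 - 'X ^+ 2) * (P k 0)^`()^`()
  = 2 * 'X * (P k 0)^`() + (lam k)%:P * P k 0.
Hypothesis wronskian_G : forall k l, (lam k - lam l)%:P * G k l
  = (1 - 'X ^+ 2) * ((P k 0)^`() * P l 0 - P k 0 * (P l 0)^`()).

(** The form [u^T T v], with [T] the diagonal matrix of the parameters. It makes
    [M = I + G T] self-adjoint, because [T M = T + T G T] is symmetric. *)
Definition pairing (u v : 'cV[{poly R}]_n) : {poly R} :=
  \sum_k (t k)%:P * (u k 0 * v k 0).
Local Notation "[< u , v >]" := (pairing u v).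

Definition gram_mx : 'M[{poly R}]_n :=
  \matrix_(k, l) ((k == l)%:R + t l *: G k l).
Local Notation M := gram_mx.
Local Notation A := (\adj M).
Local Notation tau := (\det M).
Local Notation Q := (A *m P).
Hypothesis tau_neq0 : tau != 0.

Lemma pairingC u v : [< u, v >] = [< v, u >].
Proof. by apply: eq_bigr => k _; rewrite [u k 0 * _]mulrC. Qed.

Lemma pairingDr u v w : [< u, v + w >] = [< u, v >] + [< u, w >].
Proof. by rewrite -big_split; apply: eq_bigr => k _; rewrite mxE !mulrDr. Qed.

Lemma pairingZr (c : {poly R}) u v : [< u, c *: v >] = c * [< u, v >].
Proof. by rewrite mulr_sumr; apply: eq_bigr => k _; rewrite mxE; ring. Qed.

Lemma pairingNr u v : [< u, - v >] = - [< u, v >].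
Proof. by rewrite -scaleN1r pairingZr mulN1r. Qed.

Lemma deriv_pairing u v : [< u, v >]^`() = [< D u, v >] + [< u, D v >].
Proof.
rewrite raddf_sum -big_split; apply: eq_bigr => k _ /=.
by rewrite !mxE deriv_mulC derivM mulrDr.
Qed.

Lemma gram_mulE v k : (M *m v) k 0 = v k 0 + \sum_l (t l)%:P * (G k l * v l 0).
Proof.
rewrite mxE -[v k 0](_ : \sum_l (k == l)%:R * v l 0 = _); last first.
  rewrite (bigD1 k) //= eqxx mul1r big1 ?addr0 // => l lk.
  by rewrite eq_sym (negPf lk) mul0r.
rewrite -big_split; apply: eq_bigr => l _.
by rewrite !mxE mulrDl -mul_polyC mulrA.
Qed.

Lemma pairing_gram u v : [< u, M *m v >] = [< M *m u, v >].
Proof.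
rewrite /pairing.
under eq_bigr => k _ do rewrite gram_mulE !mulrDr.
under [RHS]eq_bigr => k _ do rewrite gram_mulE mulrDl mulrDr.
rewrite !big_split; congr (_ + _) => /=.
under eq_bigr => k _ do rewrite !mulr_sumr.
under [RHS]eq_bigr => k _ do rewrite mulr_suml mulr_sumr.
rewrite exchange_big; apply: eq_bigr => l _; apply: eq_bigr => k _ /=.
by rewrite G_sym; ring.
Qed.

Lemma gram_adj (v : 'cV[{poly R}]_n) : M *m (A *m v) = tau *: v.
Proof. by rewrite mulmxA mul_mx_adj mul_scalar_mx. Qed.

Lemma adj_gram (v : 'cV[{poly R}]_n) : A *m (M *m v) = tau *: v.
Proof. by rewrite mulmxA mul_adj_mx mul_scalar_mx. Qed.

Lemma gram_inj (u v : 'cV[{poly R}]_n) : M *m u = M *m v -> u = v.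
Proof.
move=> /(congr1 (mulmx A)); rewrite !adj_gram => /colP uv; apply/colP => k.
by have := uv k; rewrite !mxE => /(mulfI tau_neq0).
Qed.

Lemma pairing_adj u v : [< u, A *m v >] = [< A *m u, v >].
Proof.
apply: (mulfI tau_neq0).
have -> : tau * [< u, A *m v >] = [< M *m (A *m u), A *m v >].
  by rewrite gram_adj ![[< _, A *m v >]]pairingC pairingZr.
by rewrite -pairing_gram gram_adj pairingZr.
Qed.

(** The derivative of [M] is [P P^T T], of rank one. *)
Lemma deriv_gram_mul (v : 'cV[{poly R}]_n) : D M *m v = [< P, v >] *: P.
Proof.
apply/colP => k; rewrite !mxE mulrC mulr_sumr; apply: eq_bigr => l _.
rewrite !mxE derivD derivZ deriv_G -mul_polyC.
by rewrite -polyC_natr derivC; ring.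
Qed.

Lemma deriv_tau : tau^`() = [< P, Q >].
Proof.
rewrite deriv_det mxtrace_mulC /mxtrace /pairing.
under eq_bigr => k _ do rewrite mxE.
rewrite exchange_big; apply: eq_bigr => l _ /=; rewrite mxE mulr_sumr mulr_sumr.
apply: eq_bigr => k _; rewrite !mxE derivD derivZ deriv_G -mul_polyC.
by rewrite -polyC_natr derivC; ring.
Qed.

Lemma deriv_scalemx (c : {poly R}) (v : 'cV[{poly R}]_n) :
  D (c *: v) = c^`() *: v + c *: D v.
Proof. by apply/colP => k; rewrite !mxE derivM. Qed.

Lemma gram_mul_deriv (v : 'cV[{poly R}]_n) :
  M *m D v = D (M *m v) - [< P, v >] *: P.
Proof. by rewrite deriv_mulmx deriv_gram_mul addrAC subrr add0r. Qed.

(** In [(M Q)' = (tau P)'] the two multiples of [P] cancel because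
    [tau' = [< P, Q >]]. *)
Lemma gram_deriv_Q : M *m D Q = tau *: D P.
Proof. by rewrite gram_mul_deriv gram_adj deriv_scalemx deriv_tau addrAC subrr add0r. Qed.

Lemma pairing_derivP_Q : [< D P, Q >] = [< P, D Q >].
Proof.
rewrite pairing_adj pairingC; congr [< _, _ >]; apply: gram_inj.
by rewrite gram_adj gram_deriv_Q.
Qed.

Lemma deriv2_tau : tau^`()^`() = 2 * [< P, D Q >].
Proof. by rewrite deriv_tau deriv_pairing pairing_derivP_Q; ring. Qed.

Lemma gram_deriv2_Q :
  M *m D (D Q) = tau^`() *: D P + tau *: D (D P) - [< P, D Q >] *: P.
Proof. by rewrite gram_mul_deriv gram_deriv_Q deriv_scalemx. Qed.

(** The diagonal matrix of the eigenvalues of the seeds, acting on [v]. *)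
Definition spectral (v : 'cV[{poly R}]_n) : 'cV[{poly R}]_n :=
  \col_k ((lam k)%:P * v k 0).

(** The entries of the commutator are [(lam k - lam l) G k l], so the Wronskian
    identity shows that it has rank two. *)
Lemma gram_spectral (v : 'cV[{poly R}]_n) :
  M *m spectral v = spectral (M *m v)
    - (1 - 'X ^+ 2) *: ([< P, v >] *: D P - [< D P, v >] *: P).
Proof.
have sE u k : spectral u k 0 = (lam k)%:P * u k 0 by rewrite mxE.
apply/colP => k; rewrite [RHS]mxE [X in _ + X]mxE [X in _ - X]mxE.
rewrite gram_mulE !sE gram_mulE.
under eq_bigr => l _ do rewrite sE.
have -> : ([< P, v >] *: D P - [< D P, v >] *: P) k 0 =
    [< P, v >] * (P k 0)^`() - [< D P, v >] * P k 0 by rewrite !mxE.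
rewrite mulrDr -addrA; congr (_ + _); apply/eqP; rewrite eq_sym subr_eq.
rewrite addrC -subr_eq; apply/eqP.
rewrite !mulr_suml mulr_sumr -!sumrB mulr_sumr; apply: eq_bigr => l _.
rewrite mxE.
transitivity ((t l)%:P * v l 0 * ((lam k - lam l)%:P * G k l)).
  by rewrite polyCB; ring.
by rewrite wronskian_G; ring.
Qed.

(** The equation [T_hat Q = spectral Q], multiplied by [tau]. After applying the
    injective matrix [M], both sides are explicit in [P], [P'], [tau] and its
    derivatives, and they agree by the equation of the seeds. *)
Lemma ode_Q : ((1 - 'X ^+ 2) * tau) *: D (D Q)
  = (2 * (1 - 'X ^+ 2) * tau^`()) *: D Q - ((1 - 'X ^+ 2) * tau^`()^`()) *: Q
    + (2 * 'X * tau) *: D Q + tau *: spectral Q.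
Proof.
apply: gram_inj; rewrite !(mulmxDr, mulmxN) -!scalemxAr gram_deriv2_Q.
rewrite gram_deriv_Q gram_adj gram_spectral gram_adj -deriv_tau pairing_derivP_Q.
rewrite deriv2_tau; apply/colP => k; rewrite !mxE.
move: (tau^`()) ([< P, D Q >]) => dt h.
set w : {poly R} := 1 - _; set p := P k 0.
rewrite (_ : w * tau * _ = w * tau * (dt * p^`() - h * p)
   + tau * tau * (w * p^`()^`())); last by ring.
by rewrite ode_P -/p; ring.
Qed.

Section Transform.
Variables (p : {poly R}) (rho : 'cV[{poly R}]_n).
Hypothesis deriv_rho : D rho = p *: P.

(** With [rho] the antiderivative of [p P], this is [tau] times the transform
    [p - rho^T T M^-1 P] of [p]. *)
Definition darboux : {poly R} := tau * p - [< rho, Q >].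

(** The contributions [p tau'] and [[< p P, Q >]] cancel. *)
Lemma deriv_darboux : darboux^`() = tau * p^`() - [< rho, D Q >].
Proof.
rewrite derivB derivM deriv_pairing deriv_rho [[< p *: P, _ >]]pairingC pairingZr.
by rewrite [[< Q, _ >]]pairingC -deriv_tau; ring.
Qed.

Variable mu : R.
Hypothesis ode_p : (1 - 'X ^+ 2) * p^`()^`() = 2 * 'X * p^`() + mu%:P * p.
Hypothesis wronskian_rho : forall k, (mu - lam k)%:P * rho k 0
  = (1 - 'X ^+ 2) * (p^`() * P k 0 - p * (P k 0)^`()).

Lemma pairing_spectral : [< rho, spectral Q >] = mu%:P * [< rho, Q >]
  - (1 - 'X ^+ 2) * (p^`() * tau^`() - p * [< P, D Q >]).
Proof.
rewrite deriv_tau -pairing_derivP_Q !mulr_sumr -sumrB mulr_sumr -sumrB.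
apply: eq_bigr => k _; rewrite !mxE.
move: (\sum_j _) => q.
apply/eqP; rewrite eq_sym -subr_eq0; apply/eqP.
rewrite (_ : _ - _ = (t k)%:P * q * ((mu - lam k)%:P * rho k 0
  - (1 - 'X ^+ 2) * (p^`() * P k 0 - p * (P k 0)^`()))).
  by rewrite wronskian_rho subrr mulr0.
by rewrite polyCB; ring.
Qed.

(** The transform keeps the eigenvalue [mu] of [p]. *)
Lemma darboux_ode :
  (1 - 'X ^+ 2) * (tau * darboux^`()^`() - 2 * tau^`() * darboux^`()
                   + tau^`()^`() * darboux)
  - 2 * 'X * tau * darboux^`() = mu%:P * tau * darboux.
Proof.
have /(congr1 (pairing rho)) := ode_Q.
rewrite !pairingDr pairingNr !pairingZr pairing_spectral deriv2_tau => odeQ.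
have -> : darboux^`()^`() = tau^`() * p^`() + tau * p^`()^`()
    - p * [< P, D Q >] - [< rho, D (D Q) >].
  rewrite deriv_darboux derivB derivM deriv_pairing deriv_rho.
  by rewrite [[< p *: P, _ >]]pairingC pairingZr [[< D Q, _ >]]pairingC; ring.
rewrite deriv_darboux /darboux.
move: odeQ ode_p; move: (tau) (tau^`()) ([< P, D Q >]) => a da h.
move: ([< rho, _ >]) ([< rho, D Q >]) ([< rho, Q >]) => r2 r1 r0.
move: (p^`()) (p^`()^`()) (1 - _) => p1 p2 w odeQ odep.
rewrite (_ : _ - _ = w * da * p1 * a + a * a * (w * p2) - w * a * p * h - w * a * r2
  - 2 * w * da * (a * p1 - r1) + 2 * w * h * (a * p - r0)
  - 2 * 'X * a * (a * p1 - r1)); last by ring.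
by rewrite odep odeQ; ring.
Qed.

End Transform.

(** The transform [f |-> f - rho^T T M^-1 P], with [rho' = f P], has the inverse
    [s |-> s + P^T T y], with [y' = s M^-1 P], and then [rho = M y]. For
    [s = tau w] no denominator is left, and [f] is a polynomial if [w] is. *)
Lemma darboux_onto (w : {poly R}) y : D y = w *: Q ->
  let f := tau * w + [< P, y >] in
  D (M *m y) = f *: P /\ darboux f (M *m y) = tau ^+ 2 * w.
Proof.
move=> dy f; split.
  rewrite deriv_mulmx deriv_gram_mul dy -scalemxAr gram_adj scalerA -scalerDl.
  by rewrite addrC [w * _]mulrC.
by rewrite /darboux /f -pairing_gram gram_adj pairingZr [[< y, _ >]]pairingC; ring.
Qed.

(** The quotient [kappa / tau = g - rho^T T M^-1 sigma] is an antiderivative of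
    the product of the transforms of [p] and [q]: the derivative of [M^-1] is
    [- (M^-1 P) (M^-1 P)^T T], which completes the product. *)
Lemma deriv_darboux_gram (p q g : {poly R}) (rho sigma : 'cV[{poly R}]_n) :
  D rho = p *: P -> D sigma = q *: P -> g^`() = p * q ->
  let kappa := tau * g - [< rho, A *m sigma >] in
  kappa^`() * tau - kappa * tau^`() = darboux p rho * darboux q sigma.
Proof.
move=> drho dsigma dg kappa; set S := A *m sigma in kappa *.
have PS : [< P, S >] = [< sigma, Q >] by rewrite pairing_adj pairingC.
have dS : tau *: D S = tau^`() *: S + darboux q sigma *: Q.
  rewrite -adj_gram gram_mul_deriv gram_adj deriv_scalemx dsigma PS.
  rewrite !(mulmxDr, mulmxN) -!scalemxAr -/S -addrA; congr (_ + _).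
  by rewrite /darboux scalerA scalerBl.
rewrite /kappa derivB derivM dg deriv_pairing drho.
rewrite [[< p *: P, _ >]]pairingC pairingZr [[< S, _ >]]pairingC PS.
have /(congr1 (pairing rho)) := dS; rewrite pairingDr !pairingZr => dS'.
rewrite (_ : _ - _ = tau * tau * p * q - tau * p * [< sigma, Q >]
   + tau^`() * [< rho, S >] - tau * [< rho, D S >]); last by ring.
by rewrite dS' /darboux; ring.
Qed.

End Darboux.

(** * The exceptional polynomials as Darboux transforms *)

Lemma transformed_norm_formula (F : realFieldType) (x a : F) : 2 * x + 1 != 0 ->
  1 + a * (2 / (2 * x + 1)) != 0 ->
  2 / (2 * x + 1)
  - a * ((2 / (2 * x + 1)) * (2 / (2 * x + 1) / (1 + a * (2 / (2 * x + 1)))))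
  = 2 / (1 + 2 * x + 2 * a).
Proof.
move=> x0 H.
have H' : 1 + 2 * x + 2 * a != 0.
  rewrite (_ : _ + _ = (2 * x + 1) * (1 + a * (2 / (2 * x + 1)))).
    by rewrite mulf_neq0.
  by field.
have -> : 1 + a * (2 / (2 * x + 1)) = (1 + 2 * x + 2 * a) / (2 * x + 1) by field.
by field; rewrite H' x0.
Qed.

Section Exceptional.
Variables (R : realType) (n : nat) (m : n.-tuple nat) (t : nat -> R).
Local Notation P := (legendre R).
Local Notation D := (map_mx (@deriv R)).
Local Notation lam := (@legendre_eigenvalue R).
Local Notation tp := (fun k : 'I_n => t (tnth m k)).
Local Notation PP := (legendre_col R m).
Local Notation tau := (tau_poly m t).

Definition legendre_gram : 'M[{poly R}]_n :=
  \matrix_(k, l) legendre_int R (tnth m k) (tnth m l).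
Local Notation G := legendre_gram.

Definition seed_col (i : nat) : 'cV[{poly R}]_n :=
  \col_k legendre_int R i (tnth m k).

Lemma R_mx_gram : R_mx m t = gram_mx tp G.
Proof. by apply/matrixP => k l; rewrite !mxE. Qed.

Lemma tau_gram : tau = \det (gram_mx tp G).
Proof. by rewrite /tau_poly R_mx_gram. Qed.

Lemma tau_neq0 : tau != 0.
Proof.
apply/eqP => tau0; have /eqP := tau_polyN1 m t.
by rewrite tau0 horner0 eq_sym oner_eq0.
Qed.

Lemma gram_tau_neq0 : \det (gram_mx tp G) != 0.
Proof. by rewrite -tau_gram tau_neq0. Qed.

Lemma legendre_gram_sym k l : G k l = G l k.
Proof. by rewrite !mxE legendre_intC. Qed.

Lemma deriv_legendre_gram k l : (G k l)^`() = PP k 0 * PP l 0.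
Proof. by rewrite !mxE deriv_legendre_int. Qed.

Lemma legendre_col_ode k : (1 - 'X ^+ 2) * (PP k 0)^`()^`()
  = 2 * 'X * (PP k 0)^`() + (lam (tnth m k))%:P * PP k 0.
Proof. by rewrite mxE legendre_ode. Qed.

Lemma legendre_gram_wronskian k l :
  (lam (tnth m k) - lam (tnth m l))%:P * G k l
  = (1 - 'X ^+ 2) * ((PP k 0)^`() * PP l 0 - PP k 0 * (PP l 0)^`()).
Proof. by rewrite !mxE wronskian_legendre. Qed.

Lemma deriv_seed_col i : D (seed_col i) = P i *: PP.
Proof. by apply/colP => k; rewrite !mxE deriv_legendre_int. Qed.

(** The last row of the adjugate of the bordered matrix annihilates its first
    [n] columns and ends with [tau], so it is determined by [\adj R_mx]. *)
Lemma exc_poly_darboux i : exc_poly m t i = darboux tp PP G (P i) (seed_col i).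
Proof.
rewrite /darboux -R_mx_gram -/tau.
set B := R_mx [tuple of rcons m i] t; set A := \adj (R_mx m t).
pose f (k : 'I_n) : 'I_n.+1 := widen_ord (leqnSn n) k.
have fl k : f k = lift ord_max k by apply/val_inj; rewrite /= /bump leqNgt ltn_ord.
have tn k : tnth [tuple of rcons m i] (f k) = tnth m k.
  by rewrite !(tnth_nth 0%N) /= nth_rcons size_tuple ltn_ord.
have tmax : tnth [tuple of rcons m i] ord_max = i.
  by rewrite !(tnth_nth 0%N) /= nth_rcons size_tuple ltnn eqxx.
have Bff k l : B (f k) (f l) = R_mx m t k l.
  by rewrite !mxE !tn.
have Bmax l : B ord_max (f l) = t (tnth m l) *: legendre_int R i (tnth m l).
  by rewrite mxE tn tmax fl (negPf (neq_lift _ _)) add0r.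
have amax : \adj B ord_max ord_max = tau.
  rewrite mxE /cofactor addnn -mul2n exprM sqrrN !expr1n mul1r /tau_poly.
  by congr (\det _); apply/matrixP => k l; rewrite !mxE -!fl !tn.
pose a : 'rV[{poly R}]_n := \row_k \adj B ord_max (f k).
have aR : a *m R_mx m t = - (tau *: (\row_l (t (tnth m l) *: legendre_int R i (tnth m l)))).
  apply/rowP => l.
  have /matrixP/(_ ord_max (f l)) := mul_adj_mx B.
  rewrite mxE big_ord_recr /= amax Bmax fl !mxE (negPf (neq_lift _ _)) mulr0n.
  move/eqP; rewrite addr_eq0 => /eqP <-.
  by apply: eq_bigr => k _; rewrite -fl Bff !mxE.
have aE : a = - ((\row_l (t (tnth m l) *: legendre_int R i (tnth m l))) *m A).
  have /(congr1 (mulmx^~ A)) := aR.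
  rewrite -mulmxA mul_mx_adj -/tau mul_mx_scalar mulNmx -scalemxAl => aA.
  apply/rowP => l; have /rowP/(_ l) := aA; rewrite !mxE.
  by rewrite -mulrN => /(mulfI tau_neq0).
rewrite /exc_poly /Q_col mxE big_ord_recr /= -/B amax addrC.
rewrite mxE tmax; congr (_ + _).
transitivity ((a *m PP) 0 0).
  by rewrite mxE; apply: eq_bigr => k _; rewrite !mxE tn.
rewrite aE mulNmx mxE -mulmxA mxE; congr (- _); apply: eq_bigr => k _.
by rewrite !mxE -mul_polyC mulrA.
Qed.

Lemma exc_poly_ode i (T := exc_poly m t i) :
  (1 - 'X ^+ 2) * (tau * T^`()^`() - 2 * tau^`() * T^`() + tau^`()^`() * T)
  - 2 * 'X * tau * T^`() = (lam i)%:P * tau * T.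
Proof.
rewrite /T exc_poly_darboux tau_gram.
apply: (darboux_ode legendre_gram_sym deriv_legendre_gram legendre_col_ode
  legendre_gram_wronskian gram_tau_neq0 (deriv_seed_col i) (legendre_ode R i)).
by move=> k; rewrite !mxE wronskian_legendre.
Qed.

Lemma exc_poly_eigen i z : tau.[z] != 0 ->
  T_hat tau (exc_poly m t i) z = lam i * (exc_poly m t i).[z].
Proof.
move=> tz; have /(congr1 (fun p : {poly R} => p.[z])) := exc_poly_ode i.
rewrite /T_hat !derivSn !derivn0; move: (exc_poly m t i) => T.
move: (tau^`()^`()) (tau^`()) (tau) tz => t2 t1 t0 tz.
move: (T^`()^`()) (T^`()) => T2 T1.
rewrite !(hornerM, hornerD, hornerN, hornerX, horner_exp, hornerC) => H.
apply: (mulfI tz); rewrite [RHS]mulrCA [RHS]mulrA -H.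
by field.
Qed.

Lemma horner_pairing (u v : 'cV[{poly R}]_n) z : (pairing tp u v).[z] =
  \sum_k t (tnth m k) * ((u k 0).[z] * (v k 0).[z]).
Proof.
by rewrite horner_sum; apply: eq_bigr => k _; rewrite !hornerM hornerC.
Qed.

(** After division by [tau], an antiderivative of the product of two exceptional
    polynomials for the weight [tau^-2]. *)
Definition kappa i j : {poly R} := tau * legendre_int R i j -
  pairing tp (seed_col i) (\adj (R_mx m t) *m seed_col j).

Lemma deriv_kappa i j :
  (kappa i j)^`() * tau - kappa i j * tau^`() = exc_poly m t i * exc_poly m t j.
Proof.
rewrite /kappa !exc_poly_darboux tau_gram R_mx_gram.
apply: (deriv_darboux_gram legendre_gram_sym deriv_legendre_gram gram_tau_neq0
  (deriv_seed_col i) (deriv_seed_col j)).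
by rewrite deriv_legendre_int.
Qed.

Lemma kappaN1 i j : (kappa i j).[-1] = 0.
Proof.
rewrite /kappa hornerD hornerN hornerM legendre_intN1 mulr0 horner_pairing.
rewrite big1 ?subr0 // => k _.
by rewrite mxE legendre_intN1 mul0r mulr0.
Qed.

Local Notation c i := (2 / (2 * i%:R + 1) : R).

Lemma legendre_norm_gt0 i : 0 < c i.
Proof. by rewrite divr_gt0 // ltr_wpDl // mulr_ge0. Qed.

Hypothesis m_uniq : uniq m.

(** Orthogonality of the distinct seeds makes the matrix diagonal at [1]. *)
Lemma R_mx1 k l :
  (R_mx m t k l).[1] = (k == l)%:R * (1 + t (tnth m k) * c (tnth m k)).
Proof.
rewrite mxE hornerD hornerZ legendre_int1.
have -> : (tnth m k == tnth m l) = (k == l).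
  by rewrite !(tnth_nth 0%N) nth_uniq ?size_tuple.
case: eqP => [<-|_]; last by rewrite horner0 !mul0r mulr0 addr0.
by rewrite (hornerC 1) !mul1r.
Qed.

Lemma tau_poly1 : tau.[1] = \prod_k (1 + t (tnth m k) * c (tnth m k)).
Proof.
rewrite -[LHS]/(horner_eval 1 (\det (R_mx m t))) -det_map_mx.
rewrite [map_mx _ _](_ : _ = diag_mx (\row_k (1 + t (tnth m k) * c (tnth m k)))).
  by rewrite det_diag; apply: eq_bigr => k _; rewrite mxE.
apply/matrixP => k l; rewrite !mxE /horner_eval -[RHS]mulr_natl -R_mx1.
by rewrite !mxE.
Qed.

Hypothesis tau1 : tau.[1] != 0.

Lemma tau_factor_neq0 k : 1 + t (tnth m k) * c (tnth m k) != 0.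
Proof. by move: tau1; rewrite tau_poly1 => /prodf_neq0; apply. Qed.

(** At [1] the system [M S = tau rho_j] is diagonal, with a right-hand side that
    is nonzero only if [j] is one of the seeds. *)
Lemma adj_seed1 j k : ((\adj (R_mx m t) *m seed_col j) k 0).[1] =
  tau.[1] * (c j * (j == tnth m k)%:R / (1 + t (tnth m k) * c (tnth m k))).
Proof.
set S := _ *m _; have : R_mx m t *m S = tau *: seed_col j.
  by rewrite mulmxA mul_mx_adj mul_scalar_mx.
move=> /colP/(_ k); rewrite [LHS]mxE [RHS]mxE mxE.
move=> /(congr1 (horner_eval 1)); rewrite /horner_eval horner_sum hornerM.
rewrite legendre_int1 (bigD1 k) //= hornerM R_mx1 eqxx mul1r big1 ?addr0; last first.
  by move=> l lk; rewrite hornerM R_mx1 eq_sym (negPf lk) !mul0r.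
move=> H; apply: (mulfI (tau_factor_neq0 k)); rewrite H.
by have := tau_factor_neq0 k; move: (c (tnth m k)) (c j) => a b tk; field.
Qed.

Lemma sum_eq_tnth i : \sum_(k < n) (i == tnth m k)%:R = (i \in m)%:R :> R.
Proof.
have [/tnthP[k ->]|im] := boolP (i \in m).
  rewrite (bigD1 k) //= eqxx big1 ?addr0 // => l lk.
  by rewrite !(tnth_nth 0%N) nth_uniq ?size_tuple // eq_sym [_ == _](negPf lk).
rewrite big1 // => k _; rewrite (_ : _ == _ = false) //.
by apply: contraNF im => /eqP ->; exact: mem_tnth.
Qed.

(** With [c] the squared norm of [P_i], the value is [c] if [i] is not a seed, and
    [c - t c^2 / (1 + t c) = c / (1 + t c)] if it is one. *)
Lemma kappa1 i j : (kappa i j).[1] / tau.[1] =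
  2 / (1 + 2 * i%:R + 2 * (\sum_(k < n) (i == tnth m k)%:R) * t i) * (i == j)%:R.
Proof.
have -> : (kappa i j).[1] / tau.[1] = (i == j)%:R * c i - \sum_k t (tnth m k) *
   (((i == tnth m k)%:R * c i)
    * (c j * (j == tnth m k)%:R / (1 + t (tnth m k) * c (tnth m k)))).
  rewrite /kappa hornerD hornerN hornerM horner_pairing mulrBl mulrAC divff // mul1r.
  rewrite legendre_int1 mulr_suml; congr (_ - _); apply: eq_bigr => k _.
  rewrite adj_seed1 mxE legendre_int1.
  by rewrite [_ * (tau.[1] * _)]mulrCA [t _ * _]mulrCA [LHS]mulrC mulKf.
have i0 : 2 * i%:R + 1 != 0 :> R by rewrite -natrM natr1 pnatr_eq0.
have [<-|ij] := eqVneq i j; last first.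
  rewrite mulr0 mul0r sub0r big1 ?oppr0 // => k _.
  case: (eqVneq i _) => [<-|]; last by rewrite !mul0r mulr0.
  by rewrite eq_sym (negPf ij) mulr0 mul0r !mulr0.
rewrite mulr1 mul1r sum_eq_tnth; have [/tnthP[k ik]|im] := boolP (i \in m).
  have D0 l : l != k -> (i == tnth m l) = false.
    by move=> lk; rewrite ik !(tnth_nth 0%N) nth_uniq ?size_tuple // eq_sym; exact: (negPf lk).
  rewrite (bigD1 k) //= big1 ?addr0; last first.
    by move=> l lk; rewrite D0 // !mul0r mulr0.
  have := tau_factor_neq0 k; rewrite -ik eqxx => H.
  by rewrite !mulr1 !mul1r transformed_norm_formula.
have F k : (i == tnth m k) = false.
  by apply: contraNF im => /eqP ->; exact: mem_tnth.
rewrite big1; first by rewrite mulr0 mul0r subr0 addr0 [1 + _]addrC.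
by move=> k _; rewrite F !mul0r mulr0.
Qed.

End Exceptional.

(** * Weighted integrals and degrees *)

Section RationalIntegral.
Variable R : realType.
Implicit Types p q : {poly R}.

Lemma is_derive_quotient p q (x : R) : q.[x] != 0 ->
  is_derive x 1 (fun y => p.[y] / q.[y])
    ((p^`() * q - p * q^`()).[x] / q.[x] ^+ 2).
Proof.
move=> qx.
have H := is_deriveM (is_derive_poly p x) (is_deriveV qx (is_derive_poly q x)).
apply: (is_derive_eq H).
rewrite /GRing.scale /= hornerD hornerN !hornerM.
by field.
Qed.

Lemma continuous_inv_sqr q (x : R) : q.[x] != 0 ->
  {for x, continuous (fun u => q.[u] ^- 2)}.
Proof.
move=> qx; apply: cvgV; first by rewrite expf_neq0.
have -> : (fun u => q.[u] ^+ 2) = horner (q ^+ 2).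
  by apply/funext => u; rewrite horner_exp.
by rewrite -horner_exp; exact: continuous_horner.
Qed.

Lemma Rintegral_quotient p q (k : {poly R}) : nonvanishing q ->
  k^`() * q - k * q^`() = p ->
  \int[lebesgue_measure]_(u in `[-1, 1]) (p.[u] / q.[u] ^+ 2)
  = k.[1] / q.[1] - k.[-1] / q.[-1].
Proof.
move=> q0 kqp; pose F (x : R) := k.[x] / q.[x].
have dF (x : R) : -1 <= x <= 1 -> is_derive x 1 F (p.[x] / q.[x] ^+ 2).
  by move=> x1; rewrite -kqp; exact: is_derive_quotient (q0 _ x1).
have N11 : -1 < 1 :> R by lra.
have cF (x : R) : -1 <= x <= 1 -> F y @[y --> x] --> F x.
  move=> x1; apply: differentiable_continuous.
  by apply/derivable1_diffP; exact: (@ex_derive _ _ _ _ _ _ _ (dF _ x1)).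
rewrite /Rintegral (@continuous_FTC2 _ _ F _ _ N11) //.
- apply: continuous_in_subspaceT => x; rewrite inE /= in_itv /= => x1.
  apply: cvgM; first exact: continuous_horner.
  exact: continuous_inv_sqr (q0 _ x1).
- split.
  + move=> x; rewrite in_itv /= => /andP[x1 x2].
    by apply: (@ex_derive _ _ _ _ _ _ _ (dF _ _)); rewrite !ltW.
  + by apply: cvg_at_right_filter; apply: cF; rewrite lexx ltW.
  + by apply: cvg_at_left_filter; apply: cF; rewrite lexx ltW.
- move=> x; rewrite in_itv /= => /andP[x1 x2].
  by rewrite derive1E; apply: (@derive_val _ _ _ _ _ _ _ (dF _ _)); rewrite !ltW.
Qed.

Lemma coefM_top (u v : {poly R}) a b :
  (forall k, (a < k)%N -> u`_k = 0) -> (forall k, (b < k)%N -> v`_k = 0) ->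
  (u * v)`_(a + b) = u`_a * v`_b.
Proof.
move=> ua vb; have al : (a < (a + b).+1)%N by rewrite ltnS leq_addr.
rewrite coefM (bigD1 (Ordinal al)) //= addKn big1 ?addr0 // => i ia.
have [lt|ge] := ltnP a i; first by rewrite ua ?mul0r.
rewrite vb ?mulr0 //; have {ia} : (i : nat) != a by [].
by lia.
Qed.

(** Let [a] and [b] be the degrees of [tau] and [T]. The coefficient of [X^(a+b)]
    in the equation gives [(b - a) (b - a + 1) = i (i + 1)], so [b - a] is [i] or
    [- i - 1]; the second value would make [b] negative when [i >= a]. *)
Lemma size_eigenpolynomial (tau T : {poly R}) (i : nat) :
  tau != 0 -> T != 0 ->
  (1 - 'X ^+ 2) * (tau * T^`()^`() - 2 * tau^`() * T^`() + tau^`()^`() * T)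
  - 2 * 'X * tau * T^`() = (legendre_eigenvalue R i)%:P * tau * T ->
  ((size tau).-1 <= i)%N -> size T = ((size tau).-1 + i).+1.
Proof.
move=> tau0 T0 ode Di.
set a := (size tau).-1; set b := (size T).-1.
have sz (p : {poly R}) : p != 0 -> (size p).-1.+1 = size p.
  by move=> p0; rewrite prednK // size_poly_gt0.
have top (p : {poly R}) k : ((size p).-1 < k)%N -> p`_k = 0.
  by move=> pk; rewrite nth_default // (leq_trans (leqSpred _)).
have d1 (p : {poly R}) k : ((size p).-1 <= k)%N -> (p^`())`_k = 0.
  by move=> pk; rewrite coef_deriv top ?mul0rn.
have d2 (p : {poly R}) k : ((size p).-1 <= k)%N -> (p^`()^`())`_k = 0.
  by move=> pk; rewrite coef_deriv d1 ?mul0rn // ltnW.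
have Xd1 (p : {poly R}) k : ('X * p^`())`_k = k%:R * p`_k.
  by rewrite coefXM coef_deriv; case: k => [|k]; rewrite ?mul0r //= mulr_natl.
have Xd2 (p : {poly R}) k : ('X ^+ 2 * p^`()^`())`_k = k%:R * (k%:R - 1) * p`_k.
  rewrite coefXnM; case: k => [|[|k]]; rewrite ?mul0r ?subrr ?mulr0 ?mul0r //=.
  rewrite subn2 /= !coef_deriv -[_ *+ k.+1]mulr_natl -[_ *+ k.+2]mulr_natl.
  by rewrite -[k.+2%:R]natr1; ring.
(* Regrouped so that every factor has degree at most [a] or [b]. *)
have := ode; rewrite (_ : _ - _ =
  tau * T^`()^`() - (tau^`() * T^`()) *+ 2 + tau^`()^`() * T
  - (tau * ('X ^+ 2 * T^`()^`()) - (('X * tau^`()) * ('X * T^`())) *+ 2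
     + ('X ^+ 2 * tau^`()^`()) * T) - (tau * ('X * T^`())) *+ 2); last by ring.
rewrite -[RHS]mulrA [RHS]mul_polyC => /(congr1 (fun p : {poly R} => p`_(a + b))).
rewrite !(coefB, coefD, coefMn, coefZ).
have Xt1 (p : {poly R}) k : ((size p).-1 < k)%N -> ('X * p^`())`_k = 0.
  by move=> pk; rewrite Xd1 top ?mulr0.
have Xt2 (p : {poly R}) k :
    ((size p).-1 < k)%N -> ('X ^+ 2 * p^`()^`())`_k = 0.
  by move=> pk; rewrite Xd2 top ?mulr0.
rewrite !coefM_top; try by [exact: top | exact: Xt1 | exact: Xt2
  | move=> k /ltnW; exact: d1 | move=> k /ltnW; exact: d2].
rewrite !Xd1 !Xd2 !d2 ?d1 // => E.
have /eqP : ((b%:R - a%:R - i%:R) * (b%:R - a%:R + i%:R + 1)) * (tau`_a * T`_b) = 0.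
  move: E; rewrite /legendre_eigenvalue -[in i.+1%:R]natr1.
  move: (tau`_a) (T`_b) (a%:R) (b%:R) (i%:R) => x y A B I E.
  apply/eqP; rewrite -oppr_eq0; apply/eqP.
  rewrite (_ : - _ = (x * 0 - (0 * 0) *+ 2 + 0 * y -
   (x * (B * (B - 1) * y) - A * x * (B * y) *+ 2 + A * (A - 1) * x * y) -
     (x * (B * y)) *+ 2) - (- (I * (I + 1)) * (x * y))); last by ring.
  by rewrite E subrr.
rewrite !mulf_eq0 -!lead_coefE !lead_coef_eq0 (negPf tau0) (negPf T0) !orbF.
case/orP => [|]; last first.
  have -> : b%:R - a%:R + i%:R + 1 = (b + i + 1 - a)%:R :> R.
    by rewrite natrB ?natrD //; [ring | lia].
  by rewrite pnatr_eq0 subn_eq0; lia.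
rewrite -addrA -opprD subr_eq0 -natrD eqr_nat => /eqP <-.
by rewrite /b sz.
Qed.

End RationalIntegral.

(** * Zeros of [tau], norms, degrees and span *)

Section ExceptionalFamily.
Variables (R : realType) (n : nat) (m : n.-tuple nat) (t : nat -> R).
Hypothesis m_uniq : uniq m.
Local Notation P := (legendre R).
Local Notation tau := (tau_poly m t).
Local Notation c i := (2 / (2 * i%:R + 1) : R).

Lemma exc_poly_pairing i1 i2 : nonvanishing tau ->
  \int[lebesgue_measure]_(u in `[-1, 1])
    ((exc_poly m t i1).[u] * (exc_poly m t i2).[u] / tau.[u] ^+ 2)
  = 2 / (1 + 2 * i1%:R + 2 * (\sum_(j < n) (i1 == tnth m j)%:R) * t i1)
    * (i1 == i2)%:R.
Proof.
move=> tau0; under eq_Rintegral => u _ do rewrite -hornerM.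
rewrite (Rintegral_quotient tau0 (deriv_kappa m t i1 i2)).
rewrite kappaN1 mul0r subr0 kappa1 //.
by apply: tau0; rewrite lexx; lra.
Qed.

(** The squared norm [2 / (1 + 2 i + 2 t)] of the polynomial of index [i = m_j] is
    nonnegative, and its denominator is, up to a positive factor, one of the
    factors of [tau.[1]]. *)
Lemma parameter_bound_nonvanishing : nonvanishing tau ->
  forall j : 'I_n, - (tnth m j)%:R - 1 / 2 < t (tnth m j).
Proof.
move=> tau0 j; set i := tnth m j.
have tau1 : tau.[1] != 0 by apply: tau0; rewrite lexx; lra.
have := exc_poly_pairing i i tau0; rewrite eqxx mulr1.
rewrite sum_eq_tnth // mem_tnth.
rewrite mulr1 => intE.
have int_ge0 : 0 <= 2 / (1 + 2 * i%:R + 2 * t i).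
  rewrite -intE; apply: Rintegral_ge0 => u _.
  by rewrite -expr2 divr_ge0 ?sqr_ge0.
have den0 : 1 + 2 * i%:R + 2 * t i != 0.
  have i0 : 2 * i%:R + 1 != 0 :> R by rewrite -natrM natr1 pnatr_eq0.
  have -> : 1 + 2 * i%:R + 2 * t i = (2 * i%:R + 1) * (1 + t i * c i) by field.
  by rewrite mulf_neq0 // tau_factor_neq0.
have : 0 < 1 + 2 * i%:R + 2 * t i.
  rewrite lt_def den0 /=; move: int_ge0.
  by rewrite pmulr_rge0 // invr_ge0.
by lra.
Qed.

Lemma primitive_ge0 (p : {poly R}) (z : R) : -1 <= z ->
  (forall x, 0 <= p.[x]) -> 0 <= (primitive p).[z].
Proof.
move=> z1 p0; rewrite -(primitiveN1 p); apply: poly_nondecreasing => // x _.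
by rewrite deriv_primitive.
Qed.

(** Let [v] be in the kernel of [M] at [z], let [f] be the combination of the seeds
    with coefficients [v], and let [s l] be the integral of [f P_(m_l)] on
    [[-1, z]]; then [v l = - t l * s l]. The combination [g] of the seeds with
    coefficients [s l / c l], [c l] the squared norms, is the projection of
    [f], cut off at [z], on their span. Bessel's inequality
    [0 <= int_(-1)^z (f - g)^2 + int_z^1 g^2] becomes
    [0 <= - sum_l (t l + 1 / c l) (s l)^2], and all the coefficients
    [t l + 1 / c l = t l + m_l + 1 / 2] are positive, so [s] and [v] vanish. *)
Lemma nonvanishing_parameter_bound :
  (forall j : 'I_n, - (tnth m j)%:R - 1 / 2 < t (tnth m j)) -> nonvanishing tau.
Proof.
move=> tm z /andP[z1 z2]; apply/negP => tauz.
have /det0P[v v0 vR] : \det (map_mx (horner_eval z) (R_mx m t)) == 0.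
  by rewrite det_map_mx.
pose f : {poly R} := \sum_k v 0 k *: P (tnth m k).
pose s (l : 'I_n) : R := (primitive (f * P (tnth m l))).[z].
have vE l : v 0 l = - (t (tnth m l) * s l).
  have /rowP/(_ l) := vR; rewrite !mxE => H.
  apply/eqP; rewrite -addr_eq0 -[X in _ == X]H; apply/eqP.
  have -> : s l = \sum_k v 0 k * (legendre_int R (tnth m k) (tnth m l)).[z].
    rewrite /s /f mulr_suml primitive_sum horner_sum; apply: eq_bigr => k _.
    by rewrite -scalerAl primitiveZ hornerZ -legendre_int_primitive.
  rewrite mulr_sumr -[v 0 l](_ : \sum_k v 0 k * (k == l)%:R = _); last first.
    rewrite (bigD1 l) //= eqxx mulr1 big1 ?addr0 // => k kl.
    by rewrite (negPf kl) mulr0.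
  rewrite -big_split; apply: eq_bigr => k _ /=; rewrite !mxE /horner_eval.
  rewrite [in RHS]hornerD [in RHS]hornerZ.
  by rewrite -[(k == l)%:R in RHS]polyC_natr [in RHS]hornerC; ring.
have c0 l : c (tnth m l) != 0 by rewrite gt_eqF // legendre_norm_gt0.
pose g : {poly R} := \sum_k (s k / c (tnth m k)) *: P (tnth m k).
have ff : (primitive (f * f)).[z] = - \sum_l t (tnth m l) * s l ^+ 2.
  rewrite {2}/f mulr_sumr primitive_sum horner_sum -sumrN.
  apply: eq_bigr => l _; rewrite -scalerAr primitiveZ hornerZ -/(s l) vE; ring.
have fg : (primitive (f * g)).[z] = \sum_l s l ^+ 2 / c (tnth m l).
  rewrite /g mulr_sumr primitive_sum horner_sum.
  apply: eq_bigr => l _; rewrite -scalerAr primitiveZ hornerZ -/(s l).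
  by rewrite mulrAC.
have gP l : (primitive (g * P (tnth m l))).[1] = s l.
  have -> : primitive (g * P (tnth m l)) = \sum_k (s k / c (tnth m k)) *:
      legendre_int R (tnth m k) (tnth m l).
    rewrite /g mulr_suml primitive_sum; apply: eq_bigr => k _.
    by rewrite -scalerAl primitiveZ legendre_int_primitive.
  rewrite horner_sum (bigD1 l) //= hornerZ legendre_int1 eqxx mul1r divfK //.
  rewrite big1 ?addr0 // => k kl; rewrite hornerZ legendre_int1.
  rewrite !(tnth_nth 0%N) nth_uniq ?size_tuple //.
  by rewrite [_ == _](negPf kl) mul0r mulr0.
have gg : (primitive (g * g)).[1] = \sum_l s l ^+ 2 / c (tnth m l).
  rewrite {2}/g mulr_sumr primitive_sum horner_sum; apply: eq_bigr => l _.
  by rewrite -scalerAr primitiveZ hornerZ gP mulrAC.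
have ge1 : 0 <= (primitive ((f - g) * (f - g))).[z].
  by apply: primitive_ge0 => // x; rewrite hornerM -expr2 sqr_ge0.
have ge2 : (primitive (g * g)).[z] <= (primitive (g * g)).[1].
  apply: poly_nondecreasing => // x _.
  by rewrite deriv_primitive hornerM -expr2 sqr_ge0.
have : \sum_l (t (tnth m l) + (c (tnth m l))^-1) * s l ^+ 2 <= 0.
  move: ge1; rewrite (_ : (f - g) * (f - g) = f * f + (-2) *: (f * g) + g * g); last first.
    by rewrite -mul_polyC polyCN polyC_natr; ring.
  have -> : \sum_l (t (tnth m l) + (c (tnth m l))^-1) * s l ^+ 2
    = \sum_l t (tnth m l) * s l ^+ 2 + \sum_l s l ^+ 2 / c (tnth m l).
    by rewrite -big_split; apply: eq_bigr => l _; rewrite mulrDl [in X in _ + X]mulrC.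
  rewrite !primitiveD primitiveZ; move: ff fg gg ge2.
  move: (primitive (f * f)) (primitive (f * g)) (primitive (g * g)) => A B C.
  by rewrite !hornerD hornerZ => -> -> ->; lra.
have tc l : 0 < t (tnth m l) + (c (tnth m l))^-1.
  by rewrite invf_div; have := tm l; lra.
have term_ge0 l : 0 <= (t (tnth m l) + (c (tnth m l))^-1) * s l ^+ 2.
  by rewrite mulr_ge0 ?sqr_ge0 // ltW.
move=> sum_le0; have /eqP : \sum_l (t (tnth m l) + (c (tnth m l))^-1) * s l ^+ 2 == 0.
  by rewrite eq_le sum_le0 sumr_ge0.
move=> /psumr_eq0P sum0; move/negP: v0; apply; apply/eqP/rowP => l.
have /eqP := sum0 (fun l _ => term_ge0 l) l isT.
rewrite mulf_eq0 gt_eqF //= expf_eq0 /= => /eqP sl.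
by rewrite vE sl mulr0 oppr0 mxE.
Qed.

Hypothesis tau_nonvanishing : nonvanishing tau.

Lemma exc_poly_neq0 i : exc_poly m t i != 0.
Proof.
apply/eqP => T0; have := exc_poly_pairing i i tau_nonvanishing.
under eq_Rintegral => u _ do rewrite T0 horner0 !mul0r.
have den_gt0 : 0 < 1 + 2 * i%:R + 2 * (\sum_(j < n) (i == tnth m j)%:R) * t i.
  rewrite sum_eq_tnth //; have [/tnthP[j ij]|_] := boolP (i \in m).
    have := parameter_bound_nonvanishing tau_nonvanishing j; rewrite -ij mulr1.
    by lra.
  by rewrite mulr0 mul0r addr0 ltr_wpDr // mulr_ge0.
rewrite Rintegral_cst // mul0r eqxx mulr1 => /eqP.
by rewrite eq_sym mulf_eq0 pnatr_eq0 /= invr_eq0 gt_eqF.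
Qed.

(** By linearity, the transform of [f = \sum_i a_i P_i] is the combination of the
    exceptional polynomials with the same coefficients; [f] is taken to be the
    preimage of [tau w]. *)
Lemma exc_poly_span (w : {poly R}) : exists N (a : nat -> R),
  \sum_(i < N) a i *: exc_poly m t i = tau ^+ 2 * w.
Proof.
pose tp k := t (tnth m k); pose PP := legendre_col R m.
pose y : 'cV[{poly R}]_n := \col_k primitive (w * Q_col m t k 0).
have dy : map_mx (@deriv R) y = w *: Q_col m t.
  by apply/colP => k; rewrite !mxE deriv_primitive.
pose f := tau * w + pairing tp PP y.
have [df fw] : map_mx (@deriv R) (R_mx m t *m y) = f *: PP /\
    darboux tp PP (legendre_gram R m) f (R_mx m t *m y) = tau ^+ 2 * w.
  rewrite /f tau_gram R_mx_gram.
  apply: (darboux_onto (@legendre_gram_sym R n m)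
    (@deriv_legendre_gram R n m)).
  by rewrite -R_mx_gram.
have [a fE] := legendre_expansion (leqnn (size f)).
exists (size f), a; rewrite -fw.
(* Both sides are antiderivatives of [f P] vanishing at [-1]. *)
have -> : R_mx m t *m y = \sum_(i < size f) (a i)%:P *: seed_col R m i.
  apply/colP => k; apply: (@poly_deriv_inj _ (-1)).
    have /colP/(_ k) := df; rewrite mxE => ->.
    rewrite summxE raddf_sum mxE {1}fE mulr_suml; apply: eq_bigr => i _ /=.
    by rewrite !mxE deriv_mulC deriv_legendre_int mul_polyC scalerAl.
  rewrite summxE horner_sum mxE horner_sum !big1 // => i _.
    by rewrite !mxE hornerM legendre_intN1 mulr0.
  by rewrite hornerM [y _ _]mxE primitiveN1 mulr0.
rewrite {1}/darboux.
transitivity (tau * f - pairing tp (Q_col m t)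
    (\sum_(i < size f) (a i)%:P *: seed_col R m i)); last first.
  by rewrite pairingC tau_gram /Q_col R_mx_gram.
have -> : pairing tp (Q_col m t) (\sum_(i < size f) (a i)%:P *: seed_col R m i)
  = \sum_(i < size f) (a i)%:P * pairing tp (Q_col m t) (seed_col R m i).
  elim/big_rec2: _ => [|i u v _ <-].
    by rewrite /pairing big1 // => k _; rewrite [X in _ * (_ * X)]mxE !mulr0.
  by rewrite pairingDr pairingZr.
rewrite [in tau * f]fE mulr_sumr -sumrB; apply: eq_bigr => i _.
rewrite exc_poly_darboux /darboux -R_mx_gram pairingC -mul_polyC -[_ *: P i]mul_polyC.
by rewrite -/(tau_poly m t); ring.
Qed.

Lemma exc_poly_degrees : finite_set
  [set d : nat | (0 < d)%N /\ ~ exists i, size (exc_poly m t i) = d.+1].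
Proof.
apply: (sub_finite_set _ (finite_II (2 * (size tau).-1)%N)) => d [_ dT] /=.
rewrite ltnNge; apply/negP => dD; apply: dT.
exists (d - (size tau).-1)%N.
rewrite (size_eigenpolynomial (tau_neq0 m t) (exc_poly_neq0 _) (exc_poly_ode m t _)).
  by rewrite subnKC // (leq_trans _ dD) // leq_pmull.
by rewrite leq_subRL ?addnn -?mul2n // (leq_trans _ dD) // leq_pmull.
Qed.

End ExceptionalFamily.

(** * Bernstein polynomials on [[-1, 1]] *)

Section Bernstein.
Variable R : realType.
Implicit Types (phi psi : nat -> R) (u a : R) (k : nat).

(** The value at [u] is the expectation of [phi j], where [j] is the number of
    upward steps among [k] independent steps, up with probability [(1 + u) / 2]
    and down with probability [(1 - u) / 2]. Conditioning on the first step gives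
    the recursion. *)
Fixpoint bernstein k phi : {poly R} :=
  if k is k'.+1 then
    (2^-1 *: (1 - 'X)) * bernstein k' phi
    + (2^-1 *: (1 + 'X)) * bernstein k' (fun j => phi j.+1)
  else (phi 0%N)%:P.

Lemma bernsteinS k phi u : (bernstein k.+1 phi).[u] =
  (1 - u) / 2 * (bernstein k phi).[u]
  + (1 + u) / 2 * (bernstein k (fun j => phi j.+1)).[u].
Proof.
rewrite /= hornerD !hornerM !hornerZ !(hornerD, hornerN) hornerX (hornerC 1).
by rewrite ![2^-1 * _]mulrC.
Qed.

Lemma bernstein_cst k (c : R) u : (bernstein k (fun=> c)).[u] = c.
Proof. by elim: k => [|k IH]; rewrite ?bernsteinS ?IH /= ?hornerC //; field. Qed.

Lemma bernstein_affine k phi (a b : R) u :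
  (bernstein k (fun j => a + b * phi j)).[u] = a + b * (bernstein k phi).[u].
Proof.
elim: k phi => [|k IH] phi; first by rewrite /= !hornerC.
by rewrite !bernsteinS !IH; field.
Qed.

Lemma bernstein_le k phi psi u : -1 <= u <= 1 ->
  (forall j, (j <= k)%N -> phi j <= psi j) ->
  (bernstein k phi).[u] <= (bernstein k psi).[u].
Proof.
move=> u1; elim: k phi psi => [|k IH] phi psi le.
  by rewrite /= !hornerC le.
rewrite !bernsteinS lerD // ler_wpM2l ?IH //; try lra.
  by move=> j jk; apply: le; rewrite (leq_trans jk).
by move=> j jk; exact: le.
Qed.

(** Bias and variance: the mean of [2 j] is [k (1 + u)] and its variance is
    [k (1 - u^2)]. A general shift [a] is needed for the induction, where the
    first step changes [a] into [a - 2]. *)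
Lemma bernstein_sqr k a u : (bernstein k (fun j => (2 * j%:R - a) ^+ 2)).[u]
  = (k%:R * (1 + u) - a) ^+ 2 + k%:R * (1 - u ^+ 2).
Proof.
elim: k a => [|k IH] a; first by rewrite /= hornerC; ring.
rewrite bernsteinS IH.
rewrite [X in bernstein k X](_ : _ = fun j => (2 * j%:R - (a - 2)) ^+ 2).
  by rewrite IH -natr1; field.
by apply/funext => j; rewrite -natr1; ring.
Qed.

(** Sampling at the [k + 2] nodes [2 j / (k + 1) - 1] of [[-1, 1]]. *)
Definition bernstein_of (h : R -> R) k : {poly R} :=
  bernstein k.+1 (fun j => h (2 * j%:R / k.+1%:R - 1)).

Lemma bernstein_of_bound (h : R -> R) M k u : -1 <= u <= 1 ->
  (forall x, `|h x| <= M) -> `|(bernstein_of h k).[u]| <= M.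
Proof.
move=> u1 hM.
rewrite ler_norml; apply/andP; split.
  rewrite -[X in X <= _](bernstein_cst k.+1 _ u); apply: bernstein_le => // j _.
  by have := hM (2 * j%:R / k.+1%:R - 1); rewrite ler_norml => /andP[].
rewrite -[X in _ <= X](bernstein_cst k.+1 _ u); apply: bernstein_le => // j _.
by have := hM (2 * j%:R / k.+1%:R - 1); rewrite ler_norml => /andP[].
Qed.

(** By positivity it suffices to take the expectation of the quadratic bound, and
    the variance of the nodes around [u] is at most [1 / (k + 1)]. *)
Lemma bernstein_of_quadratic (h : R -> R) k u e b : -1 <= u <= 1 -> 0 <= b ->
  (forall x, `|h x - h u| <= e + b * (x - u) ^+ 2) ->
  `|(bernstein_of h k).[u] - h u| <= e + b / k.+1%:R.
Proof.
move=> u1 b0 hq; set y := fun j : nat => 2 * j%:R / k.+1%:R - 1 : R.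
have k0 : (k.+1%:R : R) != 0 by rewrite pnatr_eq0.
have kp : 0 < (k.+1%:R : R) by rewrite ltr0n.
have qE : (bernstein k.+1 (fun j => (y j - u) ^+ 2)).[u] <= k.+1%:R^-1.
  have := bernstein_affine k.+1 (fun j => (2 * j%:R - k.+1%:R * (1 + u)) ^+ 2) 0
    (k.+1%:R ^- 2) u.
  rewrite bernstein_sqr subrr expr0n add0r add0r.
  rewrite [X in bernstein _ X](_ : _ = fun j => (y j - u) ^+ 2); last first.
    by apply/funext => j; rewrite /y; field.
  move=> ->; rewrite -[X in _ <= X]mulr1 expr2 invfM -mulrA mulKf //.
  by rewrite ler_pM2l ?invr_gt0 //; have := sqr_ge0 u; lra.
have E a c : (bernstein k.+1 (fun j => a + c * (y j - u) ^+ 2)).[u]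
    = a + c * (bernstein k.+1 (fun j => (y j - u) ^+ 2)).[u].
  exact: bernstein_affine.
rewrite ler_distl; apply/andP; split.
  apply: (@le_trans _ _ ((bernstein k.+1 (fun j => (h u - e) + (- b) * (y j - u) ^+ 2)).[u])).
    rewrite E opprD addrA mulNr lerB // ler_wpM2l //.
  apply: bernstein_le => // j _; rewrite -/(y j); have := hq (y j).
  rewrite ler_distl => /andP[+ _].
  by move: (h (y j)) ((y j - u) ^+ 2) => ? ?; lra.
apply: (@le_trans _ _ ((bernstein k.+1 (fun j => (h u + e) + b * (y j - u) ^+ 2)).[u])).
  apply: bernstein_le => // j _; rewrite -/(y j); have := hq (y j).
  rewrite ler_distl => /andP[_ +].
  by move: (h (y j)) ((y j - u) ^+ 2) => ? ?; lra.
by rewrite E addrA lerD // ler_wpM2l.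
Qed.

Lemma bernstein_of_cvg (h : R -> R) M u : -1 <= u <= 1 ->
  (forall x, `|h x| <= M) -> h x @[x --> u] --> h u ->
  (fun k => (bernstein_of h k).[u]) @ \oo --> h u.
Proof.
move=> u1 hM cu; apply/cvgrPdist_le => e e0.
have M0 : 0 <= M by apply: le_trans (hM 0).
have e2 : 0 < e / 2 by rewrite divr_gt0.
have /= [d /= d0 hd] := (cvgrPdist_le _ _).1 cu _ e2.
have b0 : 0 <= 2 * M / d ^+ 2 by rewrite divr_ge0 ?sqr_ge0 // mulr_ge0.
(* Continuity near [u]; away from [u], [(x - u)^2 >= d^2] and [|h| <= M]. *)
have hq x : `|h x - h u| <= e / 2 + 2 * M / d ^+ 2 * (x - u) ^+ 2.
  have [xu|xu] := ltP `|u - x| d.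
    rewrite distrC (le_trans (hd _ xu)) // lerDl mulr_ge0 ?sqr_ge0 //.
  apply: (@le_trans _ _ (2 * M)).
    by rewrite mulr_natl mulr2n (le_trans (ler_normB _ _)) // lerD.
  apply: (@le_trans _ _ (2 * M / d ^+ 2 * (x - u) ^+ 2)); last first.
    by rewrite lerDr divr_ge0 // ltW.
  rewrite mulrAC -mulrA ler_peMr ?mulr_ge0 // ler_pdivlMr ?exprn_gt0 // mul1r.
  by rewrite -[(x - u) ^+ 2]real_normK ?num_real // distrC lerXn2r ?nnegrE // ltW.
near=> k; rewrite distrC.
apply: (le_trans (bernstein_of_quadratic k u1 b0 hq)).
rewrite [X in _ <= X]splitr lerD2l.
rewrite ler_pdivrMr ?ltr0n // [X in _ <= X]mulrC -ler_pdivrMr ?divr_gt0 //.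
apply: (@le_trans _ _ k%:R); last by rewrite ler_nat.
by near: k; exact: nbhs_infty_ger.
Unshelve. all: by end_near.
Qed.

End Bernstein.

(** * Density of the polynomials in [L^2] *)

Section Density.
Variable R : realType.
Implicit Types (f g h : R -> R).
Local Notation mu := (@lebesgue_measure R).
Local Notation D := (`[(-1)%R, 1%R]%classic : set R).

Definition sqdist f g : \bar R :=
  (\int[mu]_(x in D) ((f x - g x) ^+ 2)%:E)%E.

Let mD : measurable D. Proof. exact: measurable_itv. Qed.

Let muD : (mu D < +oo)%E.
Proof.
rewrite lebesgue_measure_itv /= lte_fin.
by case: ifP => _; rewrite ?ltry // -EFinD ltry.
Qed.

Lemma measurable_sqdist f g : measurable_fun D f -> measurable_fun D g ->
  measurable_fun D (EFin \o (fun x => (f x - g x) ^+ 2)).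
Proof.
move=> mf mg; apply/measurable_EFinP.
by apply: measurable_funX; exact: measurable_funB.
Qed.

Lemma measurable_horner (p : {poly R}) : measurable_fun D (horner p).
Proof.
apply: measurable_funTS; apply: continuous_measurable_fun.
exact: continuous_horner.
Qed.

Lemma sqdist_trans f g h (eps : R) : measurable_fun D f -> measurable_fun D g ->
  measurable_fun D h -> (sqdist f g < (eps / 4)%:E)%E ->
  (sqdist g h < (eps / 4)%:E)%E -> (sqdist f h < eps%:E)%E.
Proof.
move=> mf mg mh fg gh.
have le : (sqdist f h <= 2%:E * (sqdist f g + sqdist g h))%E.
  rewrite /sqdist -ge0_integralD //; last 4 first.
  - by move=> x _; rewrite lee_fin sqr_ge0.
  - exact: measurable_sqdist.
  - by move=> x _; rewrite lee_fin sqr_ge0.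
  - exact: measurable_sqdist.
  rewrite -ge0_integralZl_EFin //; last 2 first.
  - by move=> x _; rewrite -EFinD lee_fin addr_ge0 ?sqr_ge0.
  - by apply: emeasurable_funD; exact: measurable_sqdist.
  apply: ge0_le_integral => //.
  - by move=> x _; rewrite lee_fin sqr_ge0.
  - exact: measurable_sqdist.
  - by apply: measurable_funeM; apply: emeasurable_funD; exact: measurable_sqdist.
  - move=> x _; rewrite -EFinD -EFinM lee_fin.
    by have := sqr_ge0 ((f x - g x) - (g x - h x)); lra.
apply: (le_lt_trans le).
have -> : (eps%:E = 2%:E * ((eps / 4)%:E + (eps / 4)%:E))%E.
  by rewrite -EFinD -EFinM; congr (_%:E); field.
by rewrite lte_pmul2l // lteD.
Qed.

Lemma sqdist_dominated f (f_ : nat -> R -> R) (G : R -> R) (eps : R) : 0 < eps ->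
  measurable_fun D f -> (forall k, measurable_fun D (f_ k)) ->
  (forall x, D x -> f_ k x @[k --> \oo] --> f x) ->
  mu.-integrable D (EFin \o G) ->
  (forall k x, D x -> (f x - f_ k x) ^+ 2 <= G x) ->
  exists k, (sqdist f (f_ k) < eps%:E)%E.
Proof.
move=> eps0 mf mf_ cf iG fG.
have [] := @dominated_convergence _ _ _ mu D mD
  (fun k x => ((f x - f_ k x) ^+ 2)%:E) (cst 0%E) (EFin \o G).
- by move=> k; exact: measurable_sqdist.
- exact: measurable_cst.
- apply: aeW => x Dx; apply: cvg_EFin; first by apply: nearW.
  have -> : fine \o (fun k => ((f x - f_ k x) ^+ 2)%:E)
      = fun k => (f x - f_ k x) * (f x - f_ k x).
    by apply/funext => k /=; rewrite expr2.
  rewrite -[0](mulr0 (f x - f x)) -[X in _ * X](subrr (f x)).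
  by apply: cvgM; apply: cvgB; [exact: cvg_cst | exact: cf | exact: cvg_cst | exact: cf].
- exact: iG.
- by apply: aeW => x k Dx /=; rewrite lee_fin ger0_norm ?sqr_ge0 // fG.
move=> _ _; rewrite integral0 => cvg0.
have : nbhs 0%E [set y : \bar R | (y < eps%:E)%E].
  by apply: open_nbhs_nbhs; split; [exact: open_ereal_lt_ereal | rewrite /= lte_fin].
move=> /cvg0[k _ hk]; exists k; exact: (hk k (leqnn k)).
Qed.

Definition clamp (M x : R) : R := Num.min M (Num.max (- M) x).

Lemma clamp_bound M x : 0 <= M -> `|clamp M x| <= M.
Proof.
move=> M0; rewrite ler_norml /clamp ge_min lexx /= le_min le_max lexx /=.
by rewrite andbT; lra.
Qed.

Lemma clamp_id M x : `|x| <= M -> clamp M x = x.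
Proof.
rewrite ler_norml => /andP[Mx xM].
by rewrite /clamp (max_idPr Mx) (min_idPr xM).
Qed.

Lemma clampP M x : 0 <= M ->
  [\/ x <= - M /\ clamp M x = - M, `|x| <= M /\ clamp M x = x
    | M <= x /\ clamp M x = M].
Proof.
move=> M0; have [xM|Mx] := lerP x (- M).
  constructor 1; split => //; rewrite /clamp (max_idPl xM); apply/min_idPr; lra.
have [xM|/ltW xM] := lerP x M.
  by have H : `|x| <= M; [rewrite ler_norml xM ltW | constructor 2; rewrite clamp_id].
by constructor 3; split => //; rewrite /clamp; apply/min_idPl; rewrite le_max xM orbT.
Qed.

Lemma clamp_dist M x y : 0 <= M -> `|clamp M x - clamp M y| <= `|x - y|.
Proof.
move=> M0; have xy := ler_norm (x - y); have := ler_norm (- (x - y)).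
rewrite normrN => yx; rewrite ler_norml.
have [[? ->]|[/ler_normlP[? ?] ->]|[? ->]] := clampP x M0;
  have [[? ->]|[/ler_normlP[? ?] ->]|[? ->]] := clampP y M0;
  by apply/andP; split; lra.
Qed.

Lemma measurable_clamp M f : measurable_fun D f ->
  measurable_fun D (fun x => clamp M (f x)).
Proof.
move=> mf; apply: (@measurable_minr _ _ _ _ (cst M) (fun x => Num.max (- M) (f x))).
  exact: measurable_cst.
by apply: (@measurable_maxr _ _ _ _ (cst (- M)) f); first exact: measurable_cst.
Qed.

Lemma continuous_clamp M f : continuous f -> continuous (fun x => clamp M (f x)).
Proof.
move=> cf x; apply: (@continuous_min _ _ (cst M) (fun x => Num.max (- M) (f x))).
  exact: cvg_cst.
apply: (@continuous_max _ _ (cst (- M)) f); first exact: cvg_cst.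
exact: cf.
Qed.

Lemma poly_approx_bounded_continuous h M (eps : R) : 0 < eps -> continuous h ->
  (forall x, `|h x| <= M) -> exists w : {poly R}, (sqdist h (horner w) < eps%:E)%E.
Proof.
move=> eps0 ch hM; have M0 : 0 <= M by apply: le_trans (hM 0).
have [|||||k hk] := @sqdist_dominated h (fun k => horner (bernstein_of h k))
   (cst ((2 * M) ^+ 2)) eps eps0.
- by apply: measurable_funTS; exact: continuous_measurable_fun.
- by move=> k; exact: measurable_horner.
- move=> x; rewrite /= in_itv /= => Dx.
  by apply: (bernstein_of_cvg Dx hM); exact: ch.
- apply: measurable_bounded_integrable => //; exact: bounded_cst.
- move=> k x; rewrite /= in_itv /= => Dx.
  have := hM x; have := bernstein_of_bound k Dx hM; rewrite !ler_norml.
  move=> /andP[? ?] /andP[? ?]; rewrite -[X in X <= _]real_normK ?num_real //.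
  by rewrite lerXn2r ?nnegrE ?mulr_ge0 // ler_norml; apply/andP; split; lra.
by exists (bernstein_of h k).
Qed.

(** Dominated convergence, the square of [f] dominating the squared errors. *)
Lemma clamp_approx f (eps : R) : 0 < eps -> measurable_fun D f ->
  (\int[mu]_(x in D) (f x ^+ 2)%:E < +oo)%E ->
  exists k : nat, (sqdist f (fun x => clamp k%:R (f x)) < eps%:E)%E.
Proof.
move=> eps0 mf f2.
apply: (@sqdist_dominated f (fun k x => clamp k%:R (f x)) (fun x => f x ^+ 2)) => //.
- by move=> k; exact: measurable_clamp.
- move=> x _; apply: cvg_near_cst; near=> k; rewrite clamp_id //.
  by near: k; exact: nbhs_infty_ger.
- apply/integrableP; split.
    by apply/measurable_EFinP; exact: measurable_funX.
  apply: le_lt_trans f2; apply: ge0_le_integral => //.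
  + by apply/measurableT_comp => //; apply/measurable_EFinP; exact: measurable_funX.
  + by apply/measurable_EFinP; exact: measurable_funX.
  + by move=> x _ /=; rewrite ger0_norm ?sqr_ge0.
- move=> k x _; rewrite -[X in X <= _]real_normK ?num_real //.
  rewrite -[X in _ <= X]real_normK ?num_real //.
  rewrite lerXn2r ?nnegrE //; have k0 : 0 <= k%:R :> R by [].
  have [[? ->]|[_ ->]|[? ->]] := clampP (f x) k0.
  + by rewrite opprK !ler0_norm; lra.
  + by rewrite subrr normr0.
  + by rewrite !ger0_norm; lra.
Unshelve. all: by end_near.
Qed.

(** Two functions bounded by [M] satisfy [(g - h)^2 <= 2 M |g - h|], so density of
    the continuous functions in [L^1] suffices; clamping the approximant keeps
    it continuous and does not increase the distance. The factor [2 M + 1] is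
    used instead of [2 M] because it is positive. *)
Lemma continuous_approx f M (eps : R) : 0 < eps -> 0 <= M -> measurable_fun D f ->
  exists h, [/\ continuous h, forall x, `|h x| <= M &
    (sqdist (fun x => clamp M (f x)) h < eps%:E)%E].
Proof.
move=> eps0 M0 mf; pose g x := clamp M (f x).
have mg : measurable_fun D g by exact: measurable_clamp.
have ig : mu.-integrable D (EFin \o g).
  apply: measurable_bounded_integrable => //; exists M; split; first exact: num_real.
  by move=> y My x _ /=; rewrite (le_trans (clamp_bound _ M0)) // ltW.
have [g_ [cg ig_ g_0]] := approximation_continuous_integrable mD muD ig.
pose d := eps / (2 * M + 1).
have M1 : 0 < 2 * M + 1 by lra.
have d0 : 0 < d by rewrite divr_gt0.
have : nbhs 0%E [set y : \bar R | (y < d%:E)%E].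
  by apply: open_nbhs_nbhs; split; [exact: open_ereal_lt_ereal | rewrite /= lte_fin].
move=> /g_0[k _ /(_ k (leqnn k)) /= hk].
exists (fun x => clamp M (g_ k x)); split.
- by apply: continuous_clamp; exact: cg.
- by move=> x; exact: clamp_bound.
have mgk : measurable_fun D (g_ k).
  by apply: measurable_funTS; exact: continuous_measurable_fun.
have mdiff : measurable_fun D (fun x => `|(g x - g_ k x)%:E|%E : \bar R).
  apply: measurableT_comp => //; apply/measurable_EFinP; exact: measurable_funB.
apply: (@le_lt_trans _ _ (\int[mu]_(x in D) ((2 * M + 1)%:E * `|(g x - g_ k x)%:E|))%E).
  apply: ge0_le_integral => //.
  - by move=> x _; rewrite lee_fin sqr_ge0.
  - by apply: measurable_sqdist => //; exact: measurable_clamp.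
  - exact: measurable_funeM.
  - move=> x _; rewrite /= -EFinM lee_fin -[X in X <= _]real_normK ?num_real //.
    rewrite expr2 ler_pM //.
      apply: le_trans (ler_normB _ _) _.
      by have := clamp_bound (f x) M0; have := clamp_bound (g_ k x) M0; lra.
    by rewrite -[X in X - _](clamp_id (clamp_bound (f x) M0)) clamp_dist.
rewrite ge0_integralZl_EFin //; last exact: ltW.
by rewrite muleC -lte_pdivlMr // -EFinM.
Qed.

Lemma poly_dense_L2 f (eps : R) : 0 < eps -> measurable_fun D f ->
  (\int[mu]_(x in D) (f x ^+ 2)%:E < +oo)%E ->
  exists w : {poly R}, (sqdist f (horner w) < eps%:E)%E.
Proof.
move=> eps0 mf f2; have e4 : 0 < eps / 4 by rewrite divr_gt0.
have [k fk] := clamp_approx e4 mf f2.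
have e44 : 0 < eps / 4 / 4 by rewrite divr_gt0.
have [h [ch hM kh]] := continuous_approx e44 (ler0n R k) mf.
have [w hw] := poly_approx_bounded_continuous e44 ch hM.
have mk : measurable_fun D (fun x => clamp k%:R (f x)) by exact: measurable_clamp.
exists w; apply: (sqdist_trans mf mk (measurable_horner w) fk).
apply: sqdist_trans kh hw => //; last exact: measurable_horner.
by apply: measurable_funTS; exact: continuous_measurable_fun.
Qed.

End Density.

(** * Completeness *)

Section Completeness.
Variable R : realType.
Implicit Types tau : {poly R}.
Local Notation mu := (@lebesgue_measure R).
Local Notation D := (`[(-1)%R, 1%R]%classic : set R).

Lemma nonvanishing_sqr_bounds tau : nonvanishing tau ->
  exists a b : R, 0 < a /\ forall x, D x -> a <= tau.[x] ^+ 2 <= b.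
Proof.
move=> tau0; have N11 : -1 <= 1 :> R by lra.
have ct : {within `[-1, 1], continuous (horner (tau ^+ 2))}.
  by apply: continuous_subspaceT; exact: continuous_horner.
have [c /[!in_itv] c1 cmin] := EVT_min N11 ct.
have [d _ dmax] := EVT_max N11 ct.
exists (tau ^+ 2).[c], (tau ^+ 2).[d]; split.
  by rewrite horner_exp exprn_even_gt0 //= tau0.
by move=> x Dx; rewrite -horner_exp cmin // dmax.
Qed.

Lemma measurable_inv_sqr tau : nonvanishing tau ->
  measurable_fun D (fun u => tau.[u] ^- 2).
Proof.
move=> tau0; apply: subspace_continuous_measurable_fun; first exact: measurable_itv.
apply: continuous_in_subspaceT => x; rewrite inE /= in_itv /= => x1.
exact: continuous_inv_sqr (tau0 _ x1).
Qed.

(** The weighted error is [(f - tau^2 w)^2 / tau^2 = tau^2 (f / tau^2 - w)^2], and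
    [tau^2] is bounded above and below by positive constants, so [w] is chosen to
    approximate [f / tau^2] in the unweighted norm. *)
Lemma L2_complete_span tau (P : nat -> {poly R}) : nonvanishing tau ->
  (forall w : {poly R}, exists N (a : nat -> R),
     \sum_(i < N) a i *: P i = tau ^+ 2 * w) ->
  L2_complete tau P.
Proof.
move=> tau0 span f [mf f2] eps eps0.
have [a [b [a0 ab]]] := nonvanishing_sqr_bounds tau0.
have b0 : 0 < b.
  have : D 0 by rewrite /= in_itv /=; apply/andP; split; lra.
  by move=> /ab /andP[? ?]; lra.
have mD : measurable D by exact: measurable_itv.
have mt := measurable_inv_sqr tau0.
pose g x := f x / tau.[x] ^+ 2.
have mg : measurable_fun D g by exact: measurable_funM.
have g2 : (\int[mu]_(x in D) (g x ^+ 2)%:E < +oo)%E.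
  apply: (@le_lt_trans _ _ (\int[mu]_(x in D) (a^-1%:E * (f x ^+ 2 / tau.[x] ^+ 2)%:E))%E).
    apply: ge0_le_integral => //.
    - by move=> x _; rewrite lee_fin sqr_ge0.
    - by apply/measurable_EFinP; exact: measurable_funX.
    - apply: measurable_funeM; apply/measurable_EFinP.
      by apply: measurable_funM => //; exact: measurable_funX.
    - move=> x Dx; rewrite -EFinM lee_fin /g.
      have /andP[ax _] := ab x Dx; have tx : 0 < tau.[x] ^+ 2 by apply: lt_le_trans ax.
      have -> : (f x / tau.[x] ^+ 2) ^+ 2
          = (tau.[x] ^+ 2)^-1 * (f x ^+ 2 / tau.[x] ^+ 2).
        by move: (tau.[x] ^+ 2) tx => T /gt_eqF/negbT tx; field.
      rewrite ler_wpM2r ?divr_ge0 ?sqr_ge0 // lef_pV2 //.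
  rewrite ge0_integralZl_EFin //; last 3 first.
  - by move=> x _; rewrite lee_fin divr_ge0 ?sqr_ge0.
  - apply/measurable_EFinP.
    by apply: measurable_funM => //; exact: measurable_funX.
  - by rewrite invr_ge0 ltW.
  by rewrite lte_mul_pinfty // lee_fin invr_ge0 ltW.
have eb : 0 < eps / b by rewrite divr_gt0.
have [w gw] := poly_dense_L2 eb mg g2.
have [N [c cE]] := span w.
exists N, (fun i => c i).
have -> : L2_sqnorm tau (fun z => f z - \sum_(i < N) c i * (P i).[z])
  = (\int[mu]_(x in D) ((f x - (tau ^+ 2 * w).[x]) ^+ 2 / tau.[x] ^+ 2)%:E)%E.
  apply: eq_integral => x _; rewrite -cE horner_sum; congr ((_ ^+ 2 / _)%:E).
  by congr (_ - _); apply: eq_bigr => i _; rewrite hornerZ.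
have mw := measurable_horner w.
apply: (@le_lt_trans _ _ (\int[mu]_(x in D) (b%:E * ((g x - w.[x]) ^+ 2)%:E))%E).
  apply: ge0_le_integral => //.
  - by move=> x _; rewrite lee_fin divr_ge0 ?sqr_ge0.
  - apply/measurable_EFinP; apply: measurable_funM => //; apply: measurable_funX.
    by apply: measurable_funB => //; exact: measurable_horner.
  - by apply: measurable_funeM; exact: measurable_sqdist.
  - move=> x Dx; rewrite -EFinM lee_fin /g hornerM horner_exp.
    have /andP[ax bx] := ab x Dx.
    have tx : tau.[x] ^+ 2 != 0 by rewrite gt_eqF // (lt_le_trans a0).
    move: (tau.[x] ^+ 2) tx bx => T tx bx.
    have -> : (f x - T * w.[x]) ^+ 2 / T = T * (f x / T - w.[x]) ^+ 2 by field.
    by rewrite ler_wpM2r ?sqr_ge0.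
rewrite ge0_integralZl_EFin //; last 3 first.
- by move=> x _; rewrite lee_fin sqr_ge0.
- exact: measurable_sqdist.
- exact: ltW.
have -> : eps%:E = (b%:E * (eps / b)%:E)%E.
  by rewrite -EFinM mulrC divfK // gt_eqF.
by rewrite lte_pmul2l.
Qed.

End Completeness.

Theorem theorem1p6 (R : realType) (n : nat) (m : n.-tuple nat) (t : nat -> R)
    (hn : (0 < n)%N) (hm : uniq m) :
  (nonvanishing (tau_poly m t) <->
     forall j : 'I_n, - (tnth m j)%:R - 1 / 2 < t (tnth m j)) /\
  ((forall j : 'I_n, - (tnth m j)%:R - 1 / 2 < t (tnth m j)) ->
     exceptional_legendre (tau_poly m t) (exc_poly m t) /\
     (forall i1 i2 : nat,
        \int[lebesgue_measure]_(u in `[-1, 1])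
          ((exc_poly m t i1).[u] * (exc_poly m t i2).[u]
             / (tau_poly m t).[u] ^+ 2)
        = 2 / (1 + 2 * i1%:R
                 + 2 * (\sum_(j < n) (i1 == tnth m j)%:R) * t i1)
          * (i1 == i2)%:R) /\
     L2_complete (tau_poly m t) (exc_poly m t)).
Proof.
split.
  split; first exact: parameter_bound_nonvanishing.
  exact: nonvanishing_parameter_bound.
move=> /(nonvanishing_parameter_bound hm) tau0.
have pairing i1 i2 := exc_poly_pairing hm i1 i2 tau0.
have complete : L2_complete (tau_poly m t) (exc_poly m t).
  exact: L2_complete_span tau0 (exc_poly_span m t).
split; last by split.
split => //.
- move=> i; split; first exact: exc_poly_neq0.
  by exists (legendre_eigenvalue R i) => z; exact: exc_poly_eigen.
- exact: exc_poly_degrees.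
- move=> i1 i2 /eqP i12; rewrite /L2_pairing pairing.
  by rewrite (negPf i12) mulr0.
Qed.
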